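(* Let $M$ and $N$ be oriented, $n$-dimensional (smooth) manifolds with volume forms $\mu_M$ and $\mu_N$, respectively, and let $\varphi\colon M\to N$ be an orientation-preserving diffeomorphism with Jacobian determinant $J(\mu_M,\mu_N)\varphi\in C^\infty(M)$. If the Jacobian determinant is bounded uniformly on $M$, then for any $u\in L^p(M)$, $$\bigl\lVert [J(\mu_M,\mu_N)\varphi]^{-1/p}\bigr\rVert_\infty^{-1}\,\lVert u\rVert_p\;\le\;\lVert u\circ\varphi^{-1}\rVert_p\;\le\;\bigl\lVert [J(\mu_M,\mu_N)\varphi]^{1/p}\bigr\rVert_\infty\,\lVert u\rVert_p$$ for all $p\in[1,\infty]$.
   Context: A volume form on an oriented $n$-manifold is a smooth $n$-form that is everywhere positive with respect to the orientation. The Jacobian determinant $J(\mu_M,\mu_N)\varphi\in C^\infty(M)$ is the (positive) function determined by $\varphi^*\mu_N=[J(\mu_M,\mu_N)\varphi]\,\mu_M$. Functions are real-valued. $L^p(M)$ and $\lVert\cdot\rVert_p$ are taken with respect to the measure given by $\mu_M$ (for functions on $M$) or $\mu_N$ (for functions on $N$), i.e. $\lVert u\rVert_p=\bigl(\int_M|u|^p\mu_M\bigr)^{1/p}$ for $p<\infty$ and the essential supremum for $p=\infty$. Conventions: $1/\infty=0$ in exponents, and $\lVert f\rVert_\infty^{-1}=0$ if $\lVert f\rVert_\infty=\infty$. *)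

(* Defs.v *)
From HB Require Import structures.
From mathcomp Require Import all_boot all_order all_algebra.
From mathcomp Require Import all_classical all_reals all_analysis.

Set Implicit Arguments.
Unset Strict Implicit.
Unset Printing Implicit Defensive.
Import Order.TTheory GRing.Theory Num.Theory.
Import numFieldNormedType.Exports.

Local Open Scope classical_set_scope.
Local Open Scope ring_scope.

Notation borel T := (g_sigma_algebraType (@open T)).

Section lebesgue_tuple.
Variable R : realType.

Definition tuple_of_pair n (p : R * n.-tuple R) : n.+1.-tuple R :=
  [tuple of p.1 :: p.2].
Definition pair_of_tuple n (t : n.+1.-tuple R) : R * n.-tuple R :=
  (thead t, [tuple of behead t]).

Lemma measurable_tuple_of_pair n : measurable_fun setT (@tuple_of_pair n).
Proof. exact: measurable_cons. Qed.

Lemma measurable_pair_of_tuple n : measurable_fun setT (@pair_of_tuple n).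
Proof.
apply/measurable_fun_pairP; split; last exact: measurable_behead.
exact: measurable_tnth.
Qed.

Lemma tuple_of_pairK n : cancel (@tuple_of_pair n) (@pair_of_tuple n).
Proof.
by case=> x t; rewrite /pair_of_tuple theadE; congr pair; apply/val_inj.
Qed.

Section cons.
Variables (n : nat) (mu : {sigma_finite_measure set (n.-tuple R) -> \bar R}).

Definition cons_measure : set (n.+1.-tuple R) -> \bar R :=
  pushforward (@lebesgue_measure R \x mu)%E (@tuple_of_pair n).

Let cons_measure0 : cons_measure set0 = 0%E.
Proof. apply: measure0; exact: measurable_tuple_of_pair. Qed.

Let cons_measure_ge0 A : (0 <= cons_measure A)%E.
Proof. apply: measure_ge0; exact: measurable_tuple_of_pair. Qed.

Let cons_measure_sigma_additive : semi_sigma_additive cons_measure.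
Proof.
apply: measure_semi_sigma_additive; exact: measurable_tuple_of_pair.
Qed.

HB.instance Definition _ := isMeasure.Build _ _ _ cons_measure
  cons_measure0 cons_measure_ge0 cons_measure_sigma_additive.

Let cons_measure_sigma_finite : sigma_finite setT cons_measure.
Proof.
have /sigma_finiteP[F [TF ndF Foo]] := sigma_finiteT (@lebesgue_measure R).
have /sigma_finiteP[G [TG ndG Goo]] := sigma_finiteT mu.
exists (fun k => @pair_of_tuple n @^-1` (F k `*` G k)).
  rewrite -preimage_bigcup (_ : \bigcup_k _ = setT) ?preimage_setT//.
  rewrite -subTset => -[x t] _.
  have [i _ Fix] : (\bigcup_i F i) x by rewrite -TF.
  have [j _ Gjt] : (\bigcup_i G i) t by rewrite -TG.
  exists (maxn i j) => //; split => /=.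
  - by move: x Fix {TF}; exact/subsetPset/ndF/leq_maxl.
  - by move: t Gjt {TG}; exact/subsetPset/ndG/leq_maxr.
move=> k; have [mF Fk] := Foo k; have [mG Gk] := Goo k; split.
  rewrite -[X in measurable X]setTI; apply: measurable_pair_of_tuple => //.
  exact: measurableX.
rewrite /cons_measure /pushforward -comp_preimage.
rewrite (_ : _ \o _ = id); last first.
  by apply/funext => p /=; exact: tuple_of_pairK.
by rewrite preimage_id product_measure1E// lte_mul_pinfty// ge0_fin_numE.
Qed.

HB.instance Definition _ := Measure_isSigmaFinite.Build _ _ _ cons_measure
  cons_measure_sigma_finite.

End cons.

Definition dirac_nil : set (0.-tuple R) -> \bar R := dirac [tuple].

HB.instance Definition _ := Measure.on dirac_nil.

Let dirac_nil_sigma_finite : sigma_finite setT dirac_nil.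
Proof.
apply: fin_num_fun_sigma_finite; first by rewrite measure0.
by move=> A mA; rewrite /dirac_nil diracE.
Qed.

HB.instance Definition _ := @Measure_isSigmaFinite.Build _ _ _ dirac_nil
  dirac_nil_sigma_finite.

Fixpoint lebesgue_tuple n : {sigma_finite_measure set (n.-tuple R) -> \bar R} :=
  match n with
  | 0 => dirac_nil
  | n'.+1 => cons_measure (lebesgue_tuple n')
  end.

End lebesgue_tuple.

(* [lebesgue_rV R n] is Lebesgue measure on the Borel sets of R^n, obtained as
   an iterated product of the one-dimensional measure. *)
Section lebesgue_rV.
Variables (R : realType) (n : nat).

Definition rV_of_tuple (t : n.-tuple R) : borel 'rV[R]_n := \row_i tnth t i.

Lemma measurable_rV_of_tuple : measurable_fun setT rV_of_tuple.
Proof.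
pose B (qk : 'rV[rat]_n * nat) : set 'rV[R]_n :=
  ball (map_mx ratr qk.1 : 'rV[R]_n) qk.2.+1%:R^-1.
have mB qk : measurable (rV_of_tuple @^-1` B qk).
  rewrite (_ : _ @^-1` _ = \bigcap_(i in [set: 'I_n])
      ((@tnth n R ^~ i) @^-1` ball (ratr (qk.1 ord0 i) : R) qk.2.+1%:R^-1)).
    apply: fin_bigcap_measurable; first exact: finite_finset.
    move=> i _; rewrite -[X in measurable X]setTI.
    by apply: measurable_tnth => //; exact: measurable_realfun.measurable_ball.
  apply/seteqP; split => [t [_ tq] i _|t tq].
    by have := tq ord0 i; rewrite !mxE.
  split=> [|i j]; first by rewrite invr_gt0.
  by rewrite !mxE ord1; exact: tq.
apply: (@measurability _ _ _ (borel 'rV[R]_n) _ _ (@open 'rV[R]_n)) => //.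
move=> _ [U oU <-]; rewrite setTI.
rewrite (_ : _ @^-1` _ =
    \bigcup_qk (if `[< B qk `<=` U >] then rV_of_tuple @^-1` B qk else set0)).
  apply: countable_bigcupT_measurable => // qk.
  by case: ifP => _; [exact: mB|exact: measurable0].
apply/seteqP; split => [t /= Ut|t [qk _]]; last first.
  by case: asboolP => // BU; exact: BU.
have /nbhs_ballP[e /= e0 eU] : nbhs (rV_of_tuple t) U by exact: open_nbhs_nbhs.
have e20 : 0 < e / 2 by rewrite divr_gt0.
have [k _ /(_ _ (leqnn k)) /= ke] := near_infty_natSinv_lt (PosNum e20).
have kpos : 0 < k.+1%:R^-1 :> R by rewrite invr_gt0.
have ratk (i : 'I_n) : {q : rat | `|ratr q - tnth t i| < k.+1%:R^-1}.
  apply: cid; have [|q] := @rat_in_itvoo R (tnth t i) (tnth t i + k.+1%:R^-1).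
    by rewrite ltrDl.
  rewrite in_itv/= => /andP[tq qt]; exists q.
  by rewrite gtr0_norm ?subr_gt0// ltrBlDl.
pose q : 'rV[rat]_n := \row_i sval (ratk i).
exists (q, k) => //.
have Bt : B (q, k) (rV_of_tuple t).
  split=> // i j; rewrite /= !mxE; exact: (svalP (ratk j)).
case: asboolP => // -[] y By; apply: eU.
apply: (@le_ball _ _ _ (k.+1%:R^-1 + k.+1%:R^-1)).
  by rewrite [leRHS]splitr lerD// ltW.
exact: (ball_triangle (ball_sym Bt) By).
Qed.

Definition lebesgue_rV : set (borel 'rV[R]_n) -> \bar R :=
  pushforward (@lebesgue_tuple R n) rV_of_tuple.

Let lebesgue_rV0 : lebesgue_rV set0 = 0%E.
Proof. apply: measure0; exact: measurable_rV_of_tuple. Qed.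

Let lebesgue_rV_ge0 A : (0 <= lebesgue_rV A)%E.
Proof. apply: measure_ge0; exact: measurable_rV_of_tuple. Qed.

Let lebesgue_rV_sigma_additive : semi_sigma_additive lebesgue_rV.
Proof. apply: measure_semi_sigma_additive; exact: measurable_rV_of_tuple. Qed.

HB.instance Definition _ := isMeasure.Build _ _ _ lebesgue_rV
  lebesgue_rV0 lebesgue_rV_ge0 lebesgue_rV_sigma_additive.

End lebesgue_rV.
Arguments lebesgue_rV : clear implicits.

Lemma lebesgue_rV_box (R : realType) (n : nat) (A : 'I_n -> set R) :
  (forall i, measurable (A i)) ->
  lebesgue_rV R n [set x | forall i, A i (x ord0 i)] =
  (\prod_(i < n) lebesgue_measure (A i))%E.
Proof.
move=> mA; rewrite /lebesgue_rV /pushforward.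
rewrite (_ : _ @^-1` _ = [set t | forall i, A i (tnth t i)]); last first.
  by apply/seteqP; split=> t /= tA i; have := tA i; rewrite mxE.
elim: n => [|n IHn] in A mA *.
  by rewrite big_ord0 /= /dirac_nil diracE mem_set// => -[].
rewrite big_ord_recl /= -IHn//.
rewrite /cons_measure /pushforward.
rewrite -product_measure1E //; last first.
  rewrite (_ : [set t | _] = \bigcap_(i in [set: 'I_n])
      ((@tnth n R ^~ i) @^-1` A (lift ord0 i))).
    apply: fin_bigcap_measurable; first exact: finite_finset.
    move=> i _; rewrite -[X in measurable X]setTI.
    by apply: measurable_tnth => //; exact: mA.
  by apply/seteqP; split => [t tA i _|t tA i]; exact: tA.
  exact: mA.
congr (_ _); apply/seteqP; split=> -[x t] /=.
  move=> tA; split; first by have := tA ord0; rewrite (tnth_nth x).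
  by move=> i; have := tA (lift ord0 i); rewrite tnthS.
move=> [xA tA] i; case: (unliftP ord0 i) => [j|] ->.
  by rewrite tnthS; exact: tA.
by rewrite (tnth_nth x).
Qed.

(* On an open set U this is C^k (resp. C^oo) regularity of f; only the values
   of f near points of U matter. *)
Section smooth.
Variables (R : realType) (V W : normedModType R).

Fixpoint Ck_on (k : nat) (U : set V) (f : V -> W) : Prop :=
  match k with
  | 0 => forall x, U x -> {for x, continuous f}
  | k'.+1 => (forall x, U x -> differentiable f x) /\
             forall v, Ck_on k' U (fun x => 'D_v f x)
  end.

Definition smooth_on (U : set V) (f : V -> W) := forall k, Ck_on k U f.

End smooth.

(* A chart is a homeomorphism [chart_map] from the open set [chart_dom] onto the
   open set [chart_img] with inverse [chart_inv]; both functions are total and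
   unconstrained outside of these sets. *)
Record chart (R : realType) (n : nat) (T : topologicalType) := Chart {
  chart_dom : set T ;
  chart_img : set 'rV[R]_n ;
  chart_map :> T -> 'rV[R]_n ;
  chart_inv : 'rV[R]_n -> T ;
  chart_dom_open : open chart_dom ;
  chart_img_open : open chart_img ;
  chart_map_img : forall x, chart_dom x -> chart_img (chart_map x) ;
  chart_inv_dom : forall y, chart_img y -> chart_dom (chart_inv y) ;
  chart_mapK : forall x, chart_dom x -> chart_inv (chart_map x) = x ;
  chart_invK : forall y, chart_img y -> chart_map (chart_inv y) = y ;
  chart_map_continuous : forall x, chart_dom x -> {for x, continuous chart_map} ;
  chart_inv_continuous : forall y, chart_img y -> {for y, continuous chart_inv}
}.

Section local_expression.
Variables (R : realType) (n : nat) (S T : topologicalType).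
Implicit Types (f : S -> T) (c : chart R n S) (d : chart R n T).

Definition local_expr f c d : 'rV[R]_n -> 'rV[R]_n := d \o f \o chart_inv c.

Definition local_dom f c d : set 'rV[R]_n :=
  [set y | chart_img c y /\ chart_dom d (f (chart_inv c y))].

End local_expression.

Section transition.
Variables (R : realType) (n : nat) (T : topologicalType).
Implicit Types c d : chart R n T.

Definition transition c d := local_expr idfun c d.

Definition compatible c d :=
  smooth_on (local_dom idfun c d) (transition c d) /\
  smooth_on (local_dom idfun d c) (transition d c).

End transition.

(* The atlas is a maximal smooth atlas. The carrier is pointed because
   measurable types are. *)
Record manifold (R : realType) (n : nat) := Manifold {
  carrier :> ptopologicalType ;
  manifold_hausdorff : hausdorff_space carrier ;
  manifold_second_countable : @second_countable carrier ;
  atlas : set (chart R n carrier) ;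
  atlas_cover : forall x, exists2 c, atlas c & chart_dom c x ;
  atlas_compatible : forall c d, atlas c -> atlas d -> compatible c d ;
  atlas_maximal : forall c, (forall d, atlas d -> compatible c d) -> atlas c
}.
Arguments atlas {R n}.

Section structures.
Variables (R : realType) (n : nat) (M : manifold R n).
Notation chartM := (chart R n M).

(* [reversed o c x] says that the coordinate frame of the chart c at x is
   negatively oriented; this also covers points with a negative sign when
   n = 0. *)
Record orientation := Orientation {
  reversed : chartM -> M -> bool ;
  reversed_locally_constant : forall c x, atlas M c -> chart_dom c x ->
    \forall y \near x, reversed c y = reversed c x ;
  reversed_transition : forall c d x, atlas M c -> atlas M d ->
    chart_dom c x -> chart_dom d x ->
    0 < (-1) ^+ reversed c x * (-1) ^+ reversed d x *
        \det ('J (transition c d) (c x))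
}.

(* [form_val w c x V] is the value of w at x on the n tangent vectors whose
   coordinates in the chart c are the rows of V. With row vectors, a change of
   charts (or a map) acts on tangent vectors by right multiplication by 'J. *)
Record nform := NForm {
  form_val : chartM -> M -> 'M[R]_n -> R ;
  form_multilinear : forall c x, atlas M c -> chart_dom c x ->
    forall (V V1 V2 : 'M[R]_n) (i : 'I_n) (a b : R),
    row i V = a *: row i V1 + b *: row i V2 ->
    row' i V1 = row' i V -> row' i V2 = row' i V ->
    form_val c x V = a * form_val c x V1 + b * form_val c x V2 ;
  form_alternating : forall c x, atlas M c -> chart_dom c x ->
    forall (V : 'M[R]_n) (i j : 'I_n), i != j -> row i V = row j V ->
    form_val c x V = 0 ;
  form_transition : forall c d x, atlas M c -> atlas M d ->
    chart_dom c x -> chart_dom d x ->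
    forall V, form_val c x V = form_val d x (V *m 'J (transition c d) (c x)) ;
  form_smooth : forall c, atlas M c -> forall V,
    smooth_on (chart_img c)
      (fun y => form_val c (chart_inv c y) V : R^o)
}.

Definition volume_form (o : orientation) (w : nform) :=
  forall c x, atlas M c -> chart_dom c x ->
  forall V : 'M[R]_n, V \in unitmx ->
  0 < (-1) ^+ reversed o c x * \det V * form_val w c x V.

(* The Borel measure given by a volume form w: in a chart it has density
   w(d/dx_1, ..., d/dx_n) with respect to dx, up to the sign making it
   positive. *)
Definition volume_measure (w : nform) (mu : {measure set (borel M) -> \bar R}) :=
  forall c, atlas M c ->
  forall A : set (borel M), measurable A -> A `<=` chart_dom c ->
  mu A = (\int[lebesgue_rV R n]_(y in chart_map c @` A)
            `|form_val w c (chart_inv c y) 1%:M|%:E)%E.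

End structures.

Section maps.
Variables (R : realType) (n : nat).
Implicit Types M N : manifold R n.

Definition smooth_map M N (f : M -> N) :=
  continuous f /\
  forall c d, atlas M c -> atlas N d ->
    smooth_on (local_dom f c d) (local_expr f c d).

Definition diffeomorphism M N (f : M -> N) (g : N -> M) :=
  [/\ smooth_map f, smooth_map g, cancel f g & cancel g f].

Definition orientation_preserving M N (oM : orientation M) (oN : orientation N)
    (f : M -> N) :=
  forall c d x, atlas M c -> atlas N d -> chart_dom c x -> chart_dom d (f x) ->
  0 < (-1) ^+ reversed oM c x * (-1) ^+ reversed oN d (f x) *
      \det ('J (local_expr f c d) (c x)).

(* f^* wN = J wM, evaluated on arbitrary tangent vectors. *)
Definition jacobian_determinant M N (wM : nform M) (wN : nform N) (f : M -> N)
    (J : M -> R) :=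
  forall c d x, atlas M c -> atlas N d -> chart_dom c x -> chart_dom d (f x) ->
  forall V : 'M[R]_n,
  form_val wN d (f x) (V *m 'J (local_expr f c d) (c x)) =
  J x * form_val wM c x V.

End maps.

(* Main.v *)
Require Import Defs.
From HB Require Import structures.
From mathcomp Require Import all_boot all_order all_algebra.
From mathcomp Require Import all_classical all_reals all_analysis.
From mathcomp Require Import measurable_realfun ess_sup_inf.
From mathcomp Require Import ring lra.

(** Write [nu] for the measure [A |-> volN (phi A)] on [M], the image of [volN]
    under [phiV]. The substitution rule says that [nu] has density [J] with
    respect to [volM]. Granted this, [nu] lies between the multiples of [volM] by
    the essential bounds of [J], and comparing the integrals of [|u| ^ p] with
    respect to the two measures gives both inequalities; for infinite [p] only
    the null sets of the two measures matter, and they coincide.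

    The density statement is needed only as two inequalities between measures,
    and only locally: near each [x0], for each [K > 1], [nu A] and
    [J x0 * volM A] agree up to the factor [K] ([volume_local]). A second
    countable space is covered by countably many such neighbourhoods
    ([le_measure_local]), and letting [K] tend to 1 turns a bound on [J] over a
    set into the same bound on [nu] over that set ([density_le],
    [density_ge]).

    In charts, the local statement has two sources. The densities of the volume
    forms are continuous and do not vanish, so they are locally constant up to a
    factor close to 1, and an alternating form of top degree scales by the
    determinant ([alternating_det]). What remains concerns
    Lebesgue measure and a C1 map [F] with invertible derivative [L] at a point
    ([lebesgue_rV_near]). Near that point [F] differs from [L] by a map that
    distorts distances by a factor close to 1. Here distances are those of the
    sup norm, whose balls are cubes: a [K]-Lipschitz map sends a cube into a cube
    with sides [K] times as long, so it enlarges volumes by at most [K ^ n]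
    ([lebesgue_rV_expanding]). This passes from dyadic cubes to Borel sets by the
    monotone class theorem ([le_measure_dyadic]). Finally [L] itself scales
    volumes by [|det L|], by Gaussian elimination and Tonelli's theorem
    ([lebesgue_rV_linear]). *)

Set Implicit Arguments.
Unset Strict Implicit.
Unset Printing Implicit Defensive.
Import Order.TTheory GRing.Theory Num.Theory.
Import numFieldNormedType.Exports.

Local Open Scope classical_set_scope.
Local Open Scope ring_scope.

(** * Borel maps and image measures *)

Section borel_maps.

Lemma open_measurable_borel (T : ptopologicalType) (U : set (borel T)) :
  @open T U -> measurable U.
Proof. exact: sub_sigma_algebra. Qed.

Lemma measurable_borel (d : measure_display) (S : measurableType d)
    (T : ptopologicalType) (D : set S) (f : S -> borel T) :
  measurable D -> (forall U, @open T U -> measurable (D `&` f @^-1` U)) ->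
  measurable_fun D f.
Proof.
move=> mD mf; apply: (@measurability _ _ _ (borel T) _ _ (@open T)) => //.
by move=> _ [U oU <-]; exact: mf.
Qed.

(** Charts and their inverses are total functions that are continuous only on an
    open set, hence the domain [D]. *)
Lemma open_continuous_borel (S T : ptopologicalType) (D : set S) (f : S -> T) :
  open D -> (forall x, D x -> {for x, continuous f}) ->
  measurable_fun (D : set (borel S)) (f : borel S -> borel T).
Proof.
move=> oD cf; apply: measurable_borel; first exact: open_measurable_borel.
move=> U oU; apply: open_measurable_borel.
rewrite openE => x [Dx Ufx]; apply: filterI; first exact: open_nbhs_nbhs.
by apply: (cf x Dx); exact: open_nbhs_nbhs.
Qed.

Lemma continuous_borel (S T : ptopologicalType) (f : S -> T) :
  continuous f -> measurable_fun setT (f : borel S -> borel T).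
Proof.
move=> cf; apply: open_continuous_borel => [|x _]; first exact: openT.
exact: cf.
Qed.

Lemma continuous_borel_real (R : realType) (S : ptopologicalType) (D : set S)
    (f : S -> R) : open D -> (forall x, D x -> {for x, continuous f}) ->
  measurable_fun (D : set (borel S)) (f : borel S -> measurableTypeR R).
Proof.
move=> oD cf.
apply: (measurability _ (RGenOpens.measurableE R)).
move=> _ [_ [a [b ->]] <-].
apply: open_measurable_borel; rewrite openE => x [Dx abfx].
apply: filterI; first exact: open_nbhs_nbhs.
by apply: (cf x Dx); apply: open_nbhs_nbhs; split; [exact: interval_open|].
Qed.

End borel_maps.

Section image_measure.
Context d1 d2 (T1 : measurableType d1) (T2 : measurableType d2).
Variables (R : realType) (mu : {measure set T1 -> \bar R}) (f : T1 -> T2).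

(** The canonical measure structure of a pushforward has the measurability of
    the map as a hidden argument; here that proof is explicit. *)
Definition image_measure (mf : measurable_fun setT f) :
    {measure set T2 -> \bar R} :=
  measure_function_pushforward__canonical__measure_function_Measure mu mf.

Lemma image_measureE (mf : measurable_fun setT f) (A : set T2) :
  image_measure mf A = mu (f @^-1` A).
Proof. by []. Qed.

End image_measure.

(** * Continuity of matrix operations *)

Section matrix_continuity.
Variable R : realType.

Lemma cvg_mx (T : Type) (F : set_system T) (FF : Filter F) m n
    (f : T -> 'M[R]_(m, n)) (l : 'M[R]_(m, n)) :
  (forall i j, f x i j @[x --> F] --> l i j) -> f @ F --> l.
Proof.
move=> fl; apply/cvg_ballP => e e0.
near=> x; split=> // i j; move: i j; near: x.
apply: filter_forall => i; apply: filter_forall => j.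
by have /cvg_ballP := fl i j; exact.
Unshelve. all: by end_near. Qed.

Lemma cvg_mulmx (T : Type) (F : set_system T) (FF : Filter F) m n p
    (f : T -> 'M[R]_(m, n)) (l : 'M[R]_(m, n)) (g : T -> 'M[R]_(n, p)) k :
  f @ F --> l -> g @ F --> k -> f x *m g x @[x --> F] --> l *m k.
Proof.
move=> fl gk; apply: cvg_mx => i j; rewrite mxE.
under eq_fun do rewrite mxE.
apply: cvg_big => [|q _].
  exact: (@pseudometric_normed_Zmodule.add_continuous R R).
by apply: cvgM; [exact: (cvg_comp f _ fl (@coord_continuous _ _ _ i q l))|
  exact: (cvg_comp g _ gk (@coord_continuous _ _ _ q j k))].
Qed.

Lemma mulmxr_continuous m n p (A : 'M[R]_(n, p)) :
  continuous (fun x : 'M[R]_(m, n) => x *m A).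
Proof.
by move=> x; apply: (@cvg_mulmx _ (nbhs x) _ m n p id) => //; exact: cvg_cst.
Qed.

End matrix_continuity.

(** * Lebesgue measure under affine maps of the line *)

Section affine_line.
Variable R : realType.
Notation leb := (@lebesgue_measure R).

Lemma measurable_affine (a c : R) :
  measurable_fun setT
    ((fun x => a * x + c) : measurableTypeR R -> measurableTypeR R).
Proof.
by apply: measurable_funD => //;
  apply: measurable_funM.
Qed.

(** Both sides are measures in [B], so intervals suffice. *)
Lemma lebesgue_measure_affine (a c : R) (B : set (measurableTypeR R)) :
  a != 0 -> measurable B ->
  leb [set x | B (a * x + c)] = (`|a|^-1%:E * leb B)%E.
Proof.
move=> a0 mB.
have na0 : 0 < `|a| by rewrite normr_gt0.
pose f : measurableTypeR R -> measurableTypeR R := fun x => a * x + c.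
have mf : measurable_fun setT f := measurable_affine a c.
pose nu := mscale (NngNum (ltW na0)) (image_measure leb mf).
suff -> : leb B = nu B.
  rewrite [nu B](_ : _ = `|a|%:E * leb (f @^-1` B))%E//.
  by rewrite muleA -EFinM mulVf ?gt_eqF// mul1e.
apply: lebesgue_measure_unique => // _ [[s t] _ <-].
rewrite [RHS](_ : _ = `|a|%:E * leb (f @^-1` `]s, t]%classic))%E//.
have itvE : f @^-1` `]s, t]%classic =
    if 0 < a then `](s - c) / a, (t - c) / a]%classic
    else `[(t - c) / a, (s - c) / a[%classic.
  apply/seteqP; rewrite /f; have [ap|an|] := ltrgt0P a; last by move/eqP: a0.
    split=> x /=; rewrite !in_itv/= ltr_pdivrMr// ler_pdivlMr// ltrBlDr lerBrDr;
    by rewrite mulrC.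
  split=> x /=; rewrite !in_itv/= ler_ndivrMr// ltr_ndivlMr// lerBrDr ltrBlDr;
  by rewrite mulrC andbC.
rewrite {}itvE; have [ap|an|] := ltrgt0P a; last by move/eqP: a0.
  rewrite !lebesgue_measure_itv/= !lte_fin ltr_pM2r ?invr_gt0// ltrD2r.
  case: ifPn => _; last by rewrite mule0.
  by rewrite -!EFinB -EFinM; congr EFin; field.
rewrite !lebesgue_measure_itv/= !lte_fin ltr_nM2r ?invr_lt0// ltrD2r.
case: ifPn => _; last by rewrite mule0.
by rewrite -!EFinB -EFinM; congr EFin; field.
Qed.

End affine_line.

(** * Lebesgue measure under linear maps *)

Section linear_maps.
Variable R : realType.
Notation leb := (@lebesgue_measure R).
Notation lam n := (lebesgue_rV R n).

Definition rV_cons n (x : R) (t : 'rV[R]_n) : borel 'rV[R]_(1 + n) :=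
  row_mx x%:M t.

Lemma rV_of_tuple_cons n (x : R) (t : n.-tuple R) :
  rV_of_tuple (tuple_of_pair (x, t)) = rV_cons x (rV_of_tuple t).
Proof.
apply/rowP => i; rewrite [LHS]mxE /rV_cons; case: (@split_ordP 1 n i) => j ->.
  rewrite [RHS](@row_mxEl R 1 1 n (x%:M) (rV_of_tuple t) 0 j).
  by rewrite mxE !ord1 mulr1n (tnth_nth x).
rewrite [RHS](@row_mxEr R 1 1 n (x%:M) (rV_of_tuple t) 0 j) mxE.
by rewrite (_ : rshift 1 j = lift ord0 j) ?tnthS//; exact/val_inj.
Qed.

Let pair_rV n (p : R * n.-tuple R) : borel 'rV[R]_(1 + n) :=
  rV_of_tuple (tuple_of_pair p).

Let measurable_pair_rV n : measurable_fun setT (@pair_rV n).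
Proof.
exact: measurableT_comp (@measurable_rV_of_tuple R (1 + n))
  (@measurable_tuple_of_pair R n).
Qed.

Let measurable_preimage_pair_rV n (E : set (borel 'rV[R]_(1 + n))) :
  measurable E -> measurable (@pair_rV n @^-1` E).
Proof.
by move=> mE; rewrite -[X in measurable X]setTI; exact: measurable_pair_rV.
Qed.

Let xsection_pair_rV n (E : set (borel 'rV[R]_(1 + n))) :
  lebesgue_tuple R n \o xsection (@pair_rV n @^-1` E) =
  fun x => lam n [set t | E (rV_cons x t)].
Proof.
apply/funext => x /=.
rewrite /lebesgue_rV /pushforward; congr (lebesgue_tuple R n _).
by apply/seteqP; split=> t; rewrite /xsection /= -rV_of_tuple_cons inE.
Qed.

Let ysection_pair_rV n (E : set (borel 'rV[R]_(1 + n))) (t : n.-tuple R) :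
  ysection (@pair_rV n @^-1` E) t = [set x | E (rV_cons x (rV_of_tuple t))].
Proof.
by apply/seteqP; split=> x; rewrite /ysection /= -rV_of_tuple_cons inE.
Qed.

(** Lebesgue measure is an iterated product with the first coordinate outermost,
    so slicing by that coordinate is its definition; slicing by the other
    coordinates, in [lebesgue_rV_rcons], is Tonelli's theorem. There the outer
    integral stays on tuples, where its integrand is known to be measurable. *)
Lemma lebesgue_rV_cons n (E : set (borel 'rV[R]_(1 + n))) :
  measurable E ->
  lam (1 + n) E = (\int[leb]_x lam n [set t | E (rV_cons x t)])%E.
Proof.
move=> mE.
transitivity ((leb \x lebesgue_tuple R n) (@pair_rV n @^-1` E))%E => //.
by rewrite /product_measure1 xsection_pair_rV.
Qed.

Lemma measurable_fun_lebesgue_rV_cons n (E : set (borel 'rV[R]_(1 + n))) :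
  measurable E ->
  measurable_fun setT
    ((fun x => lam n [set t | E (rV_cons x t)]) : R -> \bar R).
Proof.
move=> mE; rewrite -xsection_pair_rV; apply: measurable_fun_xsection.
exact: measurable_preimage_pair_rV.
Qed.

Lemma lebesgue_rV_rcons n (E : set (borel 'rV[R]_(1 + n))) :
  measurable E ->
  lam (1 + n) E = (\int[lebesgue_tuple R n]_t
                     leb [set x | E (rV_cons x (rV_of_tuple t))])%E.
Proof.
move=> mE; have mE' := measurable_preimage_pair_rV mE.
transitivity ((leb \x lebesgue_tuple R n) (@pair_rV n @^-1` E))%E => //.
have := indic_fubini_tonelli leb (lebesgue_tuple R n) mE'.
rewrite indic_fubini_tonelli_FE// indic_fubini_tonelli_GE// => fubini.
apply: (etrans fubini).
by apply: eq_integral => t _ /=; rewrite ysection_pair_rV.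
Qed.

Lemma measurable_rV_rcons_slice n (E : set (borel 'rV[R]_(1 + n)))
    (t : n.-tuple R) : measurable E ->
  measurable
    ([set x | E (rV_cons x (rV_of_tuple t))] : set (measurableTypeR R)).
Proof.
move=> mE; rewrite -ysection_pair_rV; apply: measurable_ysection.
exact: measurable_preimage_pair_rV.
Qed.

Lemma measurable_fun_lebesgue_rV_rcons n (E : set (borel 'rV[R]_(1 + n))) :
  measurable E ->
  measurable_fun setT
    ((fun t => leb [set x | E (rV_cons x (rV_of_tuple t))])
     : n.-tuple R -> \bar R).
Proof.
move=> mE; under eq_fun do rewrite -ysection_pair_rV.
apply: measurable_fun_ysection; exact: measurable_preimage_pair_rV.
Qed.

Lemma measurable_translation n (c : 'rV[R]_n) (E : set (borel 'rV[R]_n)) :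
  measurable E -> measurable ([set t | E (t + c)] : set (borel 'rV[R]_n)).
Proof.
move=> mE; rewrite -[X in measurable X]setTI.
apply: (@continuous_borel _ _ (fun t => t + c)) => // x.
by apply: (@cvgD _ _ _ (nbhs x) _ id) => //; exact: cvg_cst.
Qed.

Lemma measurable_mulmxr n m (A : 'M[R]_(n, m)) (E : set (borel 'rV[R]_m)) :
  measurable E -> measurable ([set t | E (t *m A)] : set (borel 'rV[R]_n)).
Proof.
move=> mE; rewrite -[X in measurable X]setTI.
by apply: (@continuous_borel 'rV[R]_n 'rV[R]_m (fun t => t *m A)) => //;
  exact: mulmxr_continuous.
Qed.

(** A slice is the preimage of [E] under the affine map
    [t |-> rV_cons x 0 + t *m row_mx 0 1]. *)
Lemma measurable_rV_cons_slice n (x : R) (E : set (borel 'rV[R]_(1 + n))) :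
  measurable E -> measurable ([set t | E (rV_cons x t)] : set (borel 'rV[R]_n)).
Proof.
move=> mE; rewrite (_ : [set t | _] =
    [set t | E (rV_cons x 0 + t *m row_mx 0 1%:M)]); last first.
  apply/seteqP; split=> t /=; rewrite mul_mx_row mulmx0 mulmx1.
    by rewrite /rV_cons add_row_mx addr0 add0r.
  by rewrite /rV_cons add_row_mx addr0 add0r.
have := measurable_mulmxr (row_mx 0 1%:M) (measurable_translation (rV_cons x 0) mE).
by congr (measurable _); apply/seteqP; split=> t /=; rewrite addrC.
Qed.

(** A map that moves points along the first axis, affinely with slope [a], scales
    length by [|a|] on every line parallel to that axis. [F] is the preimage of
    [E] under such a map. *)
Lemma lebesgue_rV_skew_head n (a : R) (f : 'rV[R]_n -> R)
    (E F : set (borel 'rV[R]_(1 + n))) :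
  a != 0 -> measurable E -> measurable F ->
  (forall x t, F (rV_cons x t) <-> E (rV_cons (a * x + f t) t)) ->
  lam (1 + n) F = (`|a|^-1%:E * lam (1 + n) E)%E.
Proof.
move=> a0 mE mF FE; rewrite !lebesgue_rV_rcons// -ge0_integralZl//; 
  last exact: measurable_fun_lebesgue_rV_rcons.
apply: eq_integral => t _; rewrite -(lebesgue_measure_affine (f (rV_of_tuple t)))//.
  by congr (leb _); apply/seteqP; split=> x /= /FE.
exact: measurable_rV_rcons_slice.
Qed.

(** The same for a map that preserves the first coordinate and on each slice
    multiplies the volumes of preimages by [c]. *)
Lemma lebesgue_rV_skew_tail n (c : R) (g : R -> 'rV[R]_n -> 'rV[R]_n)
    (E F : set (borel 'rV[R]_(1 + n))) :
  0 <= c -> measurable E -> measurable F ->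
  (forall x t, F (rV_cons x t) <-> E (rV_cons x (g x t))) ->
  (forall x (B : set (borel 'rV[R]_n)), measurable B ->
    lam n [set t | B (g x t)] = (c%:E * lam n B)%E) ->
  lam (1 + n) F = (c%:E * lam (1 + n) E)%E.
Proof.
move=> c0 mE mF FE gB; rewrite !lebesgue_rV_cons// -ge0_integralZl//; 
  last exact: measurable_fun_lebesgue_rV_cons.
apply: eq_integral => x _; rewrite -(gB x)//; last exact: measurable_rV_cons_slice.
by congr (lebesgue_rV R n _); apply/seteqP; split=> t /= /FE.
Qed.

Lemma rV_consP n (y : 'rV[R]_(1 + n)) :
  y = rV_cons (y 0 (lshift n 0)) (rsubmx y).
Proof.
rewrite /rV_cons -[LHS]hsubmxK; congr row_mx.
by apply/rowP => i; rewrite !mxE ord1 mulr1n.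
Qed.

Lemma rV_consD n (x y : R) (s t : 'rV[R]_n) :
  (rV_cons x s + rV_cons y t)%R = rV_cons (x + y) (s + t) :> 'rV[R]_(1 + n).
Proof. by rewrite /rV_cons add_row_mx -raddfD. Qed.

Lemma rV_cons_mul n (x a : R) (t u : 'rV[R]_n) (v : 'cV[R]_n) (D : 'M[R]_n) :
  rV_cons x t *m block_mx a%:M u v D =
  rV_cons (a * x + (t *m v) 0 0) (x *: u + t *m D).
Proof.
rewrite /rV_cons mul_row_block !mul_scalar_mx; congr row_mx.
rewrite raddfD/= scale_scalar_mx mulrC; congr (_ + _).
by rewrite [LHS]mx11_scalar.
Qed.

Lemma lebesgue_rV_translation n (c : 'rV[R]_n) (E : set (borel 'rV[R]_n)) :
  measurable E -> lam n [set t | E (t + c)] = lam n E.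
Proof.
elim: n => [|n IHn] in c E *.
  by move=> mE; congr (lebesgue_rV _ _ _); apply/seteqP; split=> t /=;
    rewrite [c]thinmx0 addr0.
move=> mE; rewrite (rV_consP c); set b := c _ _; set d := rsubmx _.
pose F := [set t : borel 'rV[R]_(1 + n) | E (t + rV_cons b 0)].
have mF : measurable F by exact: measurable_translation.
transitivity (lam (1 + n) F).
  rewrite -[RHS]mul1e; apply: (@lebesgue_rV_skew_tail n 1 (fun _ t => t + d)) => //.
  - exact: (@measurable_translation (1 + n)).

  - by move=> x t; rewrite /F/= !rV_consD addr0.
  - by move=> x B mB; rewrite IHn// mul1e.
rewrite -[RHS]mul1e -[1%E]/((1 : R)%:E) -[X in X%:E]invr1 -[X in X^-1]normr1.
apply: (@lebesgue_rV_skew_head n 1 (cst b)) => // x t.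
by rewrite /F/= rV_consD addr0 mul1r.
Qed.

(** By induction on [n]: a matrix with nonzero upper left entry is a product of
    two block triangular matrices, one acting along the first axis and the other
    preserving the first coordinate. An invertible matrix is brought to this form
    by adding a combination of the other rows to its first row, so that no
    permutations are needed. *)
Lemma lebesgue_rV_linear n (A : 'M[R]_n) (E : set (borel 'rV[R]_n)) :
  A \in unitmx -> measurable E ->
  lam n [set t | E (t *m A)] = (`|\det A|^-1%:E * lam n E)%E.
Proof.
elim: n => [|n IHn] in A E *.
  move=> _ mE; rewrite det_mx00 normr1 invr1 mul1e.
  by congr (lebesgue_rV _ _ _); apply/seteqP; split=> t /=;
    rewrite [t]thinmx0 mul0mx.
pose P (B : 'M[R]_(1 + n)) := forall E : set (borel 'rV[R]_(1 + n)),
    measurable E ->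
  lam (1 + n) [set t | E (t *m B)] = (`|\det B|^-1%:E * lam (1 + n) E)%E.
have PM (B C : 'M[R]_(1 + n)) : P B -> P C -> P (B *m C).
  move=> PB PC {}E mE; rewrite det_mulmx normrM invfM EFinM -muleA -PC//.
  rewrite -PB; last exact: measurable_mulmxr.
  by congr (lebesgue_rV _ _ _); apply/seteqP; split=> t /=; rewrite mulmxA.
have Phead (a : R) (v : 'cV[R]_n) : a != 0 -> P (block_mx a%:M 0 v 1%:M).
  move=> a0 {}E mE; rewrite det_lblock det1 mulr1 det_scalar1.
  apply: (@lebesgue_rV_skew_head n a (fun t => (t *m v) 0 0)) => //.
    exact: measurable_mulmxr.
  by move=> x t; rewrite /= rV_cons_mul mulmx1 scaler0 add0r.
have Ptail (u : 'rV[R]_n) (D : 'M[R]_n) : D \in unitmx ->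
    P (block_mx 1%:M u 0 D).
  move=> uD {}E mE; rewrite det_ublock det1 mul1r.
  apply: (@lebesgue_rV_skew_tail n _ (fun x t => t *m D + x *: u)) => //.
  - exact: measurable_mulmxr.
  - by move=> x t; rewrite /= rV_cons_mul mulmx0 mxE mul1r addr0 addrC.
  - move=> x B mB; rewrite (IHn D [set t | B (t + x *: u)])//.
      by rewrite lebesgue_rV_translation.
    exact: measurable_translation.
have Ppivot (B : 'M[R]_(1 + n)) : B \in unitmx -> ulsubmx B 0 0 != 0 -> P B.
  set a := ulsubmx B 0 0 => uB a0.
  have BE : B = block_mx a%:M 0 (dlsubmx B) 1%:M *m
      block_mx 1%:M (a^-1 *: ursubmx B) 0
        (drsubmx B - dlsubmx B *m (a^-1 *: ursubmx B)).
    rewrite mulmx_block !mul0mx !mulmx0 !mulmx1 !mul1mx !addr0.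
    rewrite mul_scalar_mx scalerA divff// scale1r addrC subrK -mx11_scalar.
    by rewrite submxK.
  have := uB; rewrite {1}BE unitmx_mul => /andP[_ uC].
  rewrite BE; apply: PM; first exact: Phead.
  by apply: Ptail; move: uC; rewrite !unitmxE det_ublock det1 mul1r.
suff Punit (B : 'M[R]_(1 + n)) : B \in unitmx -> P B by move=> uA; exact: Punit.
move=> uB; have [b0|] := eqVneq (ulsubmx B 0 0) 0; last exact: Ppivot.
(* Adding [v^T] times the lower rows to the first row makes the upper left entry
   the sum of the squares of the entries of [v]. *)
pose v := dlsubmx B.
pose S : 'M[R]_(1 + n) := block_mx 1%:M (- v^T) 0 1%:M.
pose S' : 'M[R]_(1 + n) := block_mx 1%:M v^T 0 1%:M.
have BE : B = S *m (S' *m B).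
  rewrite mulmxA mulmx_block !mul0mx !mulmx0 !mulmx1 !mul1mx !addr0 !add0r.
  by rewrite subrr -scalar_mx_block mul1mx.
rewrite BE; apply: PM; first by apply: Ptail; exact: unitmx1.
apply: Ppivot.
  by rewrite unitmx_mul uB andbT unitmxE det_ublock !det1 mulr1 unitr1.
have -> : ulsubmx (S' *m B) = ulsubmx B + v^T *m v.
  by rewrite -[X in S' *m X]submxK /S' mulmx_block block_mxKul !mul1mx.
rewrite mxE b0 add0r mxE; under eq_bigr do rewrite mxE -expr2.
apply: contraTneq uB => /eqP; rewrite psumr_eq0 => [/allP v0|i _]; last first.
  exact: sqr_ge0.
have {}v0 : v = 0.
  apply/colP => i; rewrite [RHS]mxE; apply/eqP; rewrite -sqrf_eq0.
  by apply: v0; rewrite mem_index_enum.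
rewrite unitmxE -[B]submxK -/v v0 det_ublock.
by rewrite [ulsubmx _]mx11_scalar b0 det_scalar1 mul0r unitr0.
Qed.

End linear_maps.

(** * Comparison of measures on dyadic cells *)

Lemma measurable_rV_box (R : realType) n (A : 'I_n -> set (measurableTypeR R)) :
  (forall i, measurable (A i)) ->
  measurable ([set x | forall i, A i (x ord0 i)] : set (borel 'rV[R]_n)).
Proof.
move=> mA; rewrite [X in measurable X](_ : _ = \bigcap_(i in [set: 'I_n])
    ((fun x : borel 'rV[R]_n => x ord0 i : measurableTypeR R) @^-1` A i)).
  apply: fin_bigcap_measurable; first exact: finite_finset.
  move=> i _; rewrite -[X in measurable X]setTI.
  apply: (@continuous_borel_real R 'rV[R]_n setT (fun x => x ord0 i)) => //.
  - exact: openT.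
  - by move=> x _; exact: coord_continuous.
by apply/seteqP; split=> x Ax i; [move=> _|]; exact: Ax.
Qed.

Section dyadic_cells.
Variables (R : realType) (n : nat).
Implicit Types (k : nat) (x y : 'rV[R]_n) (z : 'rV[int]_n).
Implicit Types E U W : set (borel 'rV[R]_n).

Definition cell_of k x : 'rV[int]_n := \row_i Num.floor (2 ^+ k * x 0 i).

Definition cell k z : set (borel 'rV[R]_n) := [set x | cell_of k x = z].

(** The unions of cells of level [k]. *)
Definition saturated k E :=
  forall x y, cell_of k x = cell_of k y -> E x -> E y.

Lemma cellE k z : cell k z =
  [set x | forall i, `[(z 0 i)%:~R / 2 ^+ k, (z 0 i + 1)%:~R / 2 ^+ k[%classic
                       (x 0 i)].
Proof.
have k0 : 0 < 2 ^+ k :> R by rewrite exprn_gt0.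
apply/seteqP; split=> x.
  move=> <- i /=; rewrite in_itv/= mxE ler_pdivrMr// ltr_pdivlMr// mulrC.
  exact: floor_itv.
move=> xz; apply/rowP => i; rewrite mxE; apply/floor_def.
have := xz i; rewrite /= in_itv/= ler_pdivrMr// ltr_pdivlMr//.
by rewrite [x 0 i * _]mulrC.
Qed.

Lemma measurable_cell k z : measurable (cell k z).
Proof.
rewrite cellE; apply: (@measurable_rV_box R n (fun i =>
  `[(z 0 i)%:~R / 2 ^+ k, (z 0 i + 1)%:~R / 2 ^+ k[%classic)) => i.
exact: measurable_itv.
Qed.

Lemma lebesgue_rV_cell k z : lebesgue_rV R n (cell k z) = (((2 ^+ k)^-1) ^+ n)%:E.
Proof.
have k0 : 0 < 2 ^+ k :> R by rewrite exprn_gt0.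
rewrite cellE; apply: (etrans (@lebesgue_rV_box R n (fun i =>
  `[(z 0 i)%:~R / 2 ^+ k, (z 0 i + 1)%:~R / 2 ^+ k[%classic) _)) => [i//|].
rewrite (eq_bigr (fun=> ((2 ^+ k)^-1)%:E)) => [|i _].
  by rewrite prodEFin prodr_const card_ord.
rewrite lebesgue_measure_itv/= lte_fin ltr_pM2r ?invr_gt0// ltr_int ltrDl ltr01.
by rewrite -EFinD -mulrBl -intrB addrAC subrr add0r mul1r.
Qed.

(** The levels are nested because the integer part of [u] is determined by that of
    [2 * u]. *)
Lemma cell_of_half k x y : cell_of k.+1 x = cell_of k.+1 y ->
  cell_of k x = cell_of k y.
Proof.
suff half (u : R) : Num.floor u = Num.floor ((Num.floor (2 * u))%:~R / 2 : R).
  move=> xy; apply/rowP => i; rewrite !mxE half [RHS]half !mulrA -!exprS.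
  by have := congr1 (fun z : 'rV_n => z 0 i) xy; rewrite !mxE => ->.
apply: esym; apply: floor_def.
have /andP[] := floor_itv u; have /andP[] := floor_itv (2 * u).
set m := Num.floor u; set m2 := Num.floor (2 * u) => h1 h2 h3 h4.
have : (2 * m <= m2)%R.
  rewrite -ltzD1 -(ltr_int R); apply: le_lt_trans h2.
  by rewrite intrM; lra.
have : (m2 < 2 * (m + 1))%R.
  rewrite -(ltr_int R); apply: le_lt_trans h1 _.
  by rewrite intrM; lra.
rewrite -(ltr_int R) -(ler_int R) !intrM !intrD => h5 h6.
by apply/andP; split; rewrite ?ler_pdivlMr ?ltr_pdivrMr// ?intrD; lra.
Qed.

Lemma saturated_le k l E : (k <= l)%N -> saturated k E -> saturated l E.
Proof.
move=> /subnKC <-; elim: (l - k)%N => [|d IH]; first by rewrite addn0.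
by move=> /IH; rewrite addnS => satE x y /cell_of_half; exact: satE.
Qed.

Lemma saturated_cell k z : saturated k (cell k z).
Proof. by move=> x y; rewrite /cell/= => ->. Qed.

Lemma cell_saturated k z E : saturated k E -> E `&` cell k z !=set0 ->
  E `&` cell k z = cell k z.
Proof.
move=> satE [x [Ex xz]]; apply/seteqP; split=> [y []//|y yz]; split=> //.
by apply: satE Ex; rewrite xz yz.
Qed.

(** An enumeration by natural numbers of the traces on [E] of the cells of level
    [k]. *)
Let cell_seq k E (j : nat) : set (borel 'rV[R]_n) :=
  if (pickle_inv j : option 'rV[int]_n) is Some z then E `&` cell k z else set0.

Let bigcup_cell_seq k E : \bigcup_j cell_seq k E j = E.
Proof.
apply/seteqP; split=> [x [j _]|x Ex]; rewrite /cell_seq.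
  by case: pickle_inv => // z [].
by exists (pickle (cell_of k x)) => //; rewrite pickleK_inv.
Qed.

Let trivIset_cell_seq k E : trivIset setT (cell_seq k E).
Proof.
move=> i j _ _ [x []]; rewrite /cell_seq.
have := @pickle_invK 'rV[int]_n i; have := @pickle_invK 'rV[int]_n j.
case: pickle_inv => [z|//] /= <-; case: pickle_inv => [z'|//] /= <-.
by move=> [_ <-] [_ <-].
Qed.

Lemma le_measure_cells k (mu nu : {measure set (borel 'rV[R]_n) -> \bar R}) E :
  (forall z, measurable (E `&` cell k z)) ->
  (forall z, mu (E `&` cell k z) <= nu (E `&` cell k z))%E ->
  (mu E <= nu E)%E.
Proof.
move=> mE munu; have mF j : measurable (cell_seq k E j).
  by rewrite /cell_seq; case: pickle_inv.
have mUF : measurable (\bigcup_j cell_seq k E j) by exact: bigcupT_measurable.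
have tF := @trivIset_cell_seq k E.
rewrite -[E](bigcup_cell_seq k).
rewrite (measure_semi_bigcup mu mF tF mUF) (measure_semi_bigcup nu mF tF mUF).
apply: lee_nneseries => // j _; rewrite /cell_seq.
by case: pickle_inv => [z|]; rewrite ?measure0.
Qed.

Lemma saturated_measurable k E : saturated k E -> measurable E.
Proof.
move=> satE; rewrite -(bigcup_cell_seq k E); apply: bigcupT_measurable => j.
rewrite /cell_seq; case: pickle_inv => // z.
have [->//|/set0P/(cell_saturated satE) ->] := eqVneq (E `&` cell k z) set0.
exact: measurable_cell.
Qed.

(** A cell of level [k] has diameter at most [2 ^- k], so each point of [U] has a
    cell inside [U]. *)
Lemma open_saturated U : open (U : set 'rV[R]_n) ->
  exists2 F : (set 'rV[R]_n)^nat, (forall k, saturated k (F k)) &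
    U = \bigcup_k F k.
Proof.
move=> oU; exists (fun k => [set x | forall y, cell_of k x = cell_of k y -> U y]).
  by move=> k x y xy Fx w yw; apply: Fx; rewrite xy.
apply/seteqP; split=> [x Ux|x [k _]]; last by apply.
have /nbhs_ballP[e /= e0 eU] : nbhs x U by exact: open_nbhs_nbhs.
have [k ke] : exists k, 2^-k < e.
  have [k _ /(_ k (leqnn k)) /= ke] := near_infty_natSinv_lt (PosNum e0).
  exists k; apply: le_lt_trans ke.
  rewrite lef_pV2 ?posrE// -?natrX ?ltr0n ?expn_gt0//.
  by rewrite ler_nat ltn_expl.
exists k => // y xy; apply: eU; split=> // i j.
rewrite ord1 /ball/=.
have k0 : 0 < 2 ^+ k :> R by rewrite exprn_gt0.
have : cell k (cell_of k x) x by [].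
have : cell k (cell_of k x) y by rewrite /cell/= xy.
rewrite !cellE => /(_ j) /= yj /(_ j) /= xj; move: xj yj; rewrite !in_itv/=.
move=> /andP[x1 x2] /andP[y1 y2]; apply: lt_trans ke.
rewrite ltr_norml.
move: x1 x2 y1 y2; rewrite intrD mulrDl mul1r.
by set a := _ / _; set b := _^-1 => *; apply/andP; split; lra.
Qed.

Let dyadic_setring : setring [set E | exists k, saturated k E].
Proof.
split.
- by exists 0%N.
- move=> A B [k sA] [l sB]; exists (maxn k l) => x y xy.
  have {}sA := saturated_le (leq_maxl k l) sA.
  have {}sB := saturated_le (leq_maxr k l) sB.
  by case=> [/(sA _ _ xy)|/(sB _ _ xy)]; [left|right].
- move=> A B [k sA] [l sB]; exists (maxn k l) => x y xy.
  have {}sA := saturated_le (leq_maxl k l) sA.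
  have {}sB := saturated_le (leq_maxr k l) sB.
  by case=> [/(sA _ _ xy) ? nBx]; split=> // /(sB _ _ (esym xy)).
Qed.

Lemma borel_sub_dyadic_sigma_ring E : measurable E ->
  <<sr [set E : set 'rV[R]_n | exists k, saturated k E]>> E.
Proof.
set D := [set E | _].
have [sr0 srD srU] := smallest_sigma_ring D.
apply: (@smallest_sub _ _ (@open 'rV[R]_n)).
  split=> // A srA; apply: srD => //.
  by apply: sub_g_sigma_ring; exists 0%N.
move=> U /open_saturated[F sF ->]; apply: srU => k.
by apply: sub_g_sigma_ring; exists k.
Qed.

(** The unions of cells of a common level, for all levels together, form a ring
    that generates the Borel sets, and cell by cell the inequality holds on it. It
    passes to monotone limits inside a cell of level 0, where both measures are
    finite, and thus to Borel sets by the monotone class theorem. *)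
Lemma le_measure_dyadic (mu nu : {measure set (borel 'rV[R]_n) -> \bar R}) :
  (forall z, nu (cell 0 z) < +oo)%E ->
  (forall k z, mu (cell k z) <= nu (cell k z))%E ->
  forall E, measurable E -> (mu E <= nu E)%E.
Proof.
move=> nufin munu E mE; apply: (@le_measure_cells 0) => z.
  by apply: measurableI => //; exact: measurable_cell.
set W := cell 0 z; have mW : measurable W by exact: measurable_cell.
pose G := [set E : set (borel 'rV[R]_n) |
  measurable E /\ (mu (E `&` W) <= nu (E `&` W))%E].
suff [] : G E by [].
have finI (m : {measure set (borel 'rV[R]_n) -> \bar R}) A :
    (m W < +oo)%E -> measurable A -> (m (A `&` W) < +oo)%E.
  move=> mWfin mA; apply: le_lt_trans mWfin; apply: le_measure; rewrite ?inE//.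
  exact: measurableI.
apply: (monotone_setring_sub_g_sigma_ring _ dyadic_setring); last 2 first.
- move=> A [k sA]; split; first exact: saturated_measurable sA.
  have sW : saturated k W := saturated_le (leq0n k) (@saturated_cell 0 z).
  have sAW : saturated k (A `&` W).
    by move=> x y xy [/(sA _ _ xy) ? /(sW _ _ xy)].
  apply: (@le_measure_cells k) => z'.
    apply: measurableI; last exact: measurable_cell.
    exact: saturated_measurable sAW.
  have [->|/set0P/(cell_saturated sAW) ->//] :=
    eqVneq (A `&` W `&` cell k z') set0; last by rewrite !measure0.
- exact: borel_sub_dyadic_sigma_ring.
split=> F monF GF.
- have mF k : measurable (F k) by have [] := GF k.
  split; first exact: bigcupT_measurable.
  have lim (m : {measure set (borel 'rV[R]_n) -> \bar R}) :
      m (F k `&` W) @[k --> \oo] --> m ((\bigcup_k F k) `&` W).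
    rewrite setI_bigcupl; apply: nondecreasing_cvg_mu.
    - by move=> k; exact: measurableI.
    - by apply: bigcupT_measurable => k; exact: measurableI.
    - move=> k l kl; apply/subsetPset; apply: setSI.
      by have /subsetPset := monF _ _ kl.
  rewrite -(cvg_lim _ (lim mu))// -(cvg_lim _ (lim nu))//; apply: lee_lim.
  + by apply/cvg_ex; eexists; exact: lim.
  + by apply/cvg_ex; eexists; exact: lim.
  + by apply: nearW => k; have [] := GF k.
- have mF k : measurable (F k) by have [] := GF k.
  split; first exact: bigcapT_measurable.
  have lim (m : {measure set (borel 'rV[R]_n) -> \bar R}) : (m W < +oo)%E ->
      m (F k `&` W) @[k --> \oo] --> m ((\bigcap_k F k) `&` W).
    move=> mWfin; rewrite -bigcapIl; last by exists 0%N.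
    apply: nonincreasing_cvg_mu.
    - exact: finI.
    - by move=> k; exact: measurableI.
    - by apply: bigcapT_measurable => k; exact: measurableI.
    - move=> k l kl; apply/subsetPset; apply: setSI.
      by have /subsetPset := monF _ _ kl.
  have nuW := nufin z; have muW := le_lt_trans (munu 0%N z) nuW.
  rewrite -(cvg_lim _ (lim mu _))// -(cvg_lim _ (lim nu _))//; apply: lee_lim.
  + by apply/cvg_ex; eexists; exact: lim.
  + by apply/cvg_ex; eexists; exact: lim.
  + by apply: nearW => k; have [] := GF k.
Qed.

End dyadic_cells.

(** * Lebesgue measure under Lipschitz maps *)

Section lipschitz.
Variables (R : realType) (n : nat).
Notation lam := (lebesgue_rV R n).

Lemma rV_norm_le (x : 'rV[R]_n) (c : R) :
  0 <= c -> (forall i, `|x 0 i| <= c) -> `|x| <= c.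
Proof.
move=> c0 xc; rewrite [leLHS]/Num.norm/= mx_normrE; apply/bigmax_leP; split=> //.
by move=> [i j] _ /=; rewrite ord1.
Qed.

Lemma rV_norm_ge (x : 'rV[R]_n) i : `|x 0 i| <= `|x|.
Proof.
rewrite [leRHS]/Num.norm/= mx_normrE; apply/bigmax_geP; right.
by exists (0, i).
Qed.

(** In the sup norm, a set of diameter [s] lies in a cube of side [s], whose lower
    corner is made of the infima of the coordinates. *)
Lemma lebesgue_rV_diameter (s : R) (S : set (borel 'rV[R]_n)) :
  0 <= s -> measurable S -> (forall x y : 'rV[R]_n, S x -> S y -> `|x - y| <= s) ->
  (lam S <= (s ^+ n)%:E)%E.
Proof.
move=> s0 mS Ss; have [->|/set0P[y Sy]] := eqVneq S set0.
  by rewrite measure0 lee_fin exprn_ge0.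
pose a i := inf [set x 0 i | x in (S : set 'rV[R]_n)].
pose A i := `[a i, a i + s]%classic.
have SA : S `<=` [set x | forall i, A i (x ord0 i)].
  move=> x Sx i; rewrite /A/= in_itv/=; apply/andP; split.
    apply: ge_inf; last by exists x.
    exists (y 0 i - s) => _ [z Sz <-]; rewrite lerBlDr -lerBlDl.
    apply: le_trans (Ss _ _ Sy Sz); apply: le_trans (rV_norm_ge _ i).
    by rewrite !mxE ler_norm.
  rewrite -lerBlDr; apply: lb_le_inf; first by exists (y 0 i), y.
  move=> _ [z Sz <-]; rewrite lerBlDr -lerBlDl.
  apply: le_trans (Ss _ _ Sx Sz); apply: le_trans (rV_norm_ge _ i).
  by rewrite !mxE ler_norm.
have mA i : measurable (A i) by exact: measurable_itv.
apply: (@le_trans _ _ (lam [set x | forall i, A i (x ord0 i)])).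
  by apply: le_measure; rewrite ?inE//; exact: measurable_rV_box.
rewrite lebesgue_rV_box// (eq_bigr (fun=> s%:E)) => [|i _].
  by rewrite prodEFin prodr_const card_ord.
rewrite lebesgue_measure_itv/= lte_fin; case: ltP => [_|].
  by rewrite -EFinB addrAC subrr add0r.
by rewrite gerDl => s0'; congr EFin; apply/le_anti/andP; split.
Qed.

Lemma cell_diameter k (z : 'rV[int]_n) (x y : 'rV[R]_n) :
  cell k z x -> cell k z y -> `|x - y| <= 2^-k.
Proof.
rewrite cellE => xz yz.
apply: rV_norm_le => [|i]; first by rewrite invr_ge0 exprn_ge0.
have := xz i; have := yz i; rewrite /= !in_itv/= !mxE intrD mulrDl mul1r.
move=> /andP[y1 y2] /andP[x1 x2]; rewrite ler_norml.
by move: x1 x2 y1 y2; set a := _ / _; set b := _^-1 => *; apply/andP; split; lra.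
Qed.

(** [H] is the inverse of a [K]-Lipschitz map from a subset of [B] onto [D]; stating
    the bound for the inverse makes the image measure [E |-> lam (D & H^-1 E)]
    available. That measure is at most [K ^ n * lam] on dyadic cells, since the
    Lipschitz image of a cell has [K] times its diameter. *)
Lemma lebesgue_rV_expanding (K : R) (D B : set (borel 'rV[R]_n))
    (H : borel 'rV[R]_n -> borel 'rV[R]_n) :
  0 <= K -> measurable D -> measurable B -> measurable_fun D H ->
  (forall y, D y -> B (H y)) ->
  (forall y y' : 'rV[R]_n, D y -> D y' ->
    `|y - y'| <= K * `|H y - H y' : 'rV[R]_n|) ->
  (lam D <= (K ^+ n)%:E * lam B)%E.
Proof.
move=> K0 mD mB mH DB HK.
have mHD : measurable_fun setT (H \_ D) by move: mH => /(measurable_restrictT _ mD).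
pose mu := image_measure (mrestr lam mD) mHD.
have muE E : mu E = lam ([set y | D y /\ E (H y)]).
  rewrite /mu image_measureE /mrestr/=; congr (lam _).
  by apply/seteqP; split=> y /=; rewrite /patch; case: ifPn => [|/negP];
    rewrite inE// => Dy; [case|case|case|case].
pose nu := mscale (NngNum (exprn_ge0 n K0)) lam.
have nuE E : nu E = ((K ^+ n)%:E * lam E)%E by [].
rewrite -nuE; apply: (@le_trans _ _ (mu B)).
  rewrite muE; apply: le_measure; rewrite ?inE//; first exact: mH.
  by move=> y Dy; split=> //; exact: DB.
apply: le_measure_dyadic => //.
- move=> z; rewrite [ltLHS](_ : _ = ((K ^+ n)%:E * lam (cell 0 z))%E)//.
  by rewrite lebesgue_rV_cell -EFinM ltry.
move=> k z; rewrite muE [leRHS](_ : _ = ((K ^+ n)%:E * lam (cell k z))%E)//.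
rewrite lebesgue_rV_cell -EFinM -exprMn.
apply: lebesgue_rV_diameter.
- by rewrite mulr_ge0// invr_ge0 exprn_ge0.
- exact: (mH mD _ (measurable_cell k z)).
- move=> y y' [Dy zy] [Dy' zy']; apply: le_trans (HK _ _ Dy Dy') _.
  by rewrite ler_wpM2l//; exact: cell_diameter zy zy'.
Qed.

End lipschitz.

(** * C1 maps near a point *)

Section C1_maps.
Variables (R : realType) (n : nat).
Notation lam := (lebesgue_rV R n).
Implicit Types (F G : 'rV[R]_n -> 'rV[R]_n) (U : set 'rV[R]_n).

Lemma mulmxr_bounded (A : 'M[R]_n) :
  exists2 c : R, 0 < c & forall x : 'rV[R]_n, `|x *m A| <= c * `|x|.
Proof.
have [c c0 Ac] := @linear_lipschitz _ _ _ (mulmxr A) (@mulmxr_continuous R 1 n n A).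
by exists c => // x; exact: Ac.
Qed.

Lemma Ck1_continuous U F x : Ck_on 1 U F -> U x -> {for x, continuous F}.
Proof. by move=> [dF _] Ux; apply: differentiable_continuous; exact: dF. Qed.

(** The rows of the Jacobian matrix are the derivatives in the directions of the
    coordinate axes. *)
Lemma jacobian_continuous U F x : open U -> Ck_on 1 U F -> U x ->
  'J F y @[y --> x] --> 'J F x.
Proof.
move=> oU [dF cF] Ux; apply: (@cvg_mx R _ (nbhs x)) => i j.
pose e : 'rV[R]_n := delta_mx 0 i.
pose g y := 'J F y i j; rewrite -[X in _ --> X]/(g x) -[X in X @ _]/g.
have gE y : U y -> g y = 'D_e F y 0 j.
  by move=> Uy; rewrite /g deriveEjacobian ?/e -?rowE ?mxE//; exact: dF.
clearbody g.
have De : ('D_e F y) 0 j @[y --> x] --> ('D_e F x) 0 j.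
  exact: (cvg_comp _ _ (cF e x Ux) (@coord_continuous _ _ _ 0 j _)).
rewrite (gE x Ux); apply: cvg_trans De; apply: near_eq_cvg.
by near=> y; apply/esym/gE; near: y; exact: open_nbhs_nbhs.
Unshelve. all: by end_near. Qed.

Lemma is_derive_line F (x v : 'rV[R]_n) (j : 'I_n) (t : R) :
  differentiable F (x + t *: v) ->
  is_derive t 1 (fun s : R => (F (x + s *: v)) 0 j) ((v *m 'J F (x + t *: v)) 0 j).
Proof.
move=> dF; set f := fun s => _; set w := x + t *: v in dF *.
have fl : h^-1 *: ((f \o shift t) (h *: 1) - f t) @[h --> 0^'] -->
    (v *m 'J F w) 0 j.
  rewrite -deriveEjacobian//.
  have Fl : h^-1 *: ((F \o shift w) (h *: v) - F w) @[h --> 0^'] --> 'D_v F w.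
    exact: diff_derivable.
  have := cvg_comp _ _ Fl (@coord_continuous _ _ _ 0 j _).
  apply: cvg_trans; apply: near_eq_cvg; near=> h.
  rewrite /= !mxE /f /= [h *: 1]mulr1; congr (_ * (F _ _ _ - _)).
  by apply/rowP => i; rewrite !mxE; ring.
apply: DeriveDef; first by apply/cvg_ex; exists ((v *m 'J F w) 0 j).
exact: cvg_lim fl.
Unshelve. all: by end_near. Qed.

Let MVT01 (f df : R -> R) :
  (forall t : R, t \in `[0, 1] -> is_derive t (1 : R) f (df t)) ->
  exists2 t : R, t \in `[0, 1] & f 1 - f 0 = df t.
Proof.
move=> fdf.
have lt01 : (0 : R) < 1 by exact: ltr01.
have oc (t : R) : t \in `]0, 1[ -> t \in `[0, 1] by exact: subset_itv_oo_cc.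
have cf : {within `[0, 1], continuous f}.
  apply: derivable_within_continuous => t t01.
  by have [] := fdf t t01.
have fdf' (t : R) : t \in `]0, 1[ -> is_derive t (1 : R) f (df t).
  by move=> /oc; exact: fdf.
have [t t01 fE] := MVT lt01 fdf' cf.
by exists t; [exact: oc|rewrite fE subr0 mulr1].
Qed.

(** The mean value theorem, applied to each coordinate of [F] on the segment from
    [x] to [y], expresses the error through [J F w - J F z] for a point [w] of the
    segment; this is small because the Jacobian matrix is continuous. *)
Lemma Ck1_near_affine U F z (d : R) : open U -> Ck_on 1 U F -> U z -> 0 < d ->
  exists2 r, 0 < r & ball z r `<=` U /\
    forall x y, ball z r x -> ball z r y ->
      `|F y - F x - (y - x) *m 'J F z| <= d * `|y - x|.
Proof.
move=> oU CF Uz d0.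
have /cvg_ballP/(_ (d / n.+1%:R)) := jacobian_continuous oU CF Uz.
rewrite divr_gt0// => /(_ isT) Jz.
have /nbhs_ballP[r /= r0 rU] : nbhs z (U `&`
    [set x | ball ('J F z) (d / n.+1%:R) ('J F x)]).
  by apply: filterI => //; exact: open_nbhs_nbhs.
exists r => //; split=> [x /rU[]//|x y zx zy].
apply: rV_norm_le => [|j]; first by rewrite mulr_ge0// ltW.
pose v := y - x; pose w (t : R) := x + t *: v.
have wz (t : R) : t \in `[0, 1] -> ball z r (w t).
  rewrite in_itv/= => /andP[t0 t1]; move: zx zy; rewrite -!ball_normE/=.
  move=> zx zy; rewrite (_ : z - w t = (1 - t) *: (z - x) + t *: (z - y)).
    apply: le_lt_trans (ler_normD _ _) _; rewrite !normrZ (ger0_norm t0).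
    rewrite ger0_norm ?subr_ge0//.
    apply: (@le_lt_trans _ _ (Num.max `|z - x| `|z - y|)).
      rewrite [leRHS](_ : _ = (1 - t) * Num.max `|z - x| `|z - y| +
          t * Num.max `|z - x| `|z - y|); last by ring.
      apply: lerD.
        by rewrite ler_wpM2l ?subr_ge0// le_max lexx.
      by rewrite ler_wpM2l// le_max lexx orbT.
    by rewrite gt_max zx.
  by rewrite /w /v; apply/rowP => i; rewrite !mxE; ring.
pose f (t : R) := F (w t) 0 j.
have fdf (t : R) : t \in `[0, 1] -> is_derive t (1 : R) f ((v *m 'J F (w t)) 0 j).
  by move=> t01; apply: is_derive_line; apply: CF.1; have [] := rU _ (wz _ t01).
have [t t01'] := MVT01 fdf.
have w1 : w 1 = y by rewrite /w /v scale1r addrC subrK.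
have w0 : w 0 = x by rewrite /w scale0r addr0.
rewrite /f w1 w0 => fE.
have -> : (F y - F x - v *m 'J F z) 0 j = (v *m ('J F (w t) - 'J F z)) 0 j.
  by rewrite mulmxBr [LHS]mxE [RHS]mxE -fE !mxE.
rewrite mxE; apply: le_trans (ler_norm_sum _ _ _) _.
apply: (@le_trans _ _ (\sum_(i < n) `|v| * (d / n.+1%:R))).
  apply: ler_sum => i _; rewrite normrM ler_pM//; first exact: rV_norm_ge.
  have [_ [_ /(_ i j) /ltW]] := rU _ (wz _ t01').
  by move: ('J F (w t)) ('J F z) => A B; rewrite distrC !mxE.
rewrite sumr_const card_ord -mulrnAr [leRHS]mulrC ler_wpM2l// -mulr_natr -mulrA.
apply: ler_piMr; first exact: ltW.
by rewrite mulrC ler_pdivrMr// mul1r ler_nat.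
Qed.

(** [D] is the image of [B] under [F], with inverse [G]. Both estimates compare [D]
    with the image [B'] of [B] under the derivative [L], whose volume is known:
    the map [x *m L |-> F x] and its inverse are [K]-Lipschitz once [F] is close
    enough to its affine approximation. *)
Lemma lebesgue_rV_near U F z (K : R) : open U -> Ck_on 1 U F -> U z ->
  'J F z \in unitmx -> 1 < K ->
  exists2 r, 0 < r & ball z r `<=` U /\
    forall (B D : set (borel 'rV[R]_n)) (G : borel 'rV[R]_n -> borel 'rV[R]_n),
    measurable B -> measurable D -> B `<=` ball z r ->
    measurable_fun D G -> (forall x, B x -> D (F x)) ->
    (forall y, D y -> B (G y) /\ F (G y) = y) ->
    (lam D <= (K ^+ n * `|\det ('J F z)|)%:E * lam B)%E /\
    ((`|\det ('J F z)|)%:E * lam B <= (K ^+ n)%:E * lam D)%E.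
Proof.
move=> oU CF Uz; set L := 'J F z => uL K1.
have K0 : 0 < K by apply: lt_trans K1.
have [c c0 Lc] := mulmxr_bounded (invmx L).
have cL (x : 'rV[R]_n) : `|x| <= c * `|x *m L|.
  by have := Lc (x *m L); rewrite mulmxK.
(* With [a = |(y - x) *m L|], the error is then at most [(1 - K^-1) * a], and
   [K^-1 * a <= |F y - F x| <= (2 - K^-1) * a <= K * a]. *)
pose d := (1 - K^-1) / c.
have d0 : 0 < d by rewrite divr_gt0// subr_gt0 invf_lt1.
have [r r0 [rU Fd]] := Ck1_near_affine oU CF Uz d0.
have {}Fd x y : ball z r x -> ball z r y ->
    `|F y - F x - (y - x) *m L| <= (1 - K^-1) * `|(y - x) *m L|.
  move=> zx zy; apply: le_trans (Fd _ _ zx zy) _.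
  rewrite /d -mulrA; apply: ler_wpM2l.
    by rewrite subr_ge0 invf_le1// ltW.
  by rewrite mulrC ler_pdivrMr// mulrC.
exists r => //; split=> // B D G mB mD Bz mG BD DB.
pose B' : set (borel 'rV[R]_n) := [set w | B (w *m invmx L)].
have mB' : measurable B' by exact: measurable_mulmxr.
have B'E : lam B' = (`|\det L|%:E * lam B)%E.
  by rewrite lebesgue_rV_linear ?unitmx_inv// det_inv normfV invrK.
split.
  rewrite EFinM -muleA -B'E.
  apply: (@lebesgue_rV_expanding _ _ K D B' (fun y => G y *m L)) => //.
  - exact: ltW.
  - exact: (measurableT_comp (@continuous_borel 'rV[R]_n 'rV[R]_n
      (fun w => w *m L) (@mulmxr_continuous R 1 n n L)) mG).
  - by move=> y /DB[BGy _]; rewrite /B'/= mulmxK.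
  - move=> y y' /DB[/Bz zy yE] /DB[/Bz zy' yE'].
    rewrite -mulmxBl -{1}yE -{1}yE'; have := Fd _ _ zy' zy.
    set a := F _ - F _; set b := (_ - _) *m L => ab.
    have := ler_normD (a - b) b; rewrite subrK => /le_trans; apply.
    apply: le_trans (lerD ab (lexx _)) _.
    rewrite -[X in _ + X]mul1r -mulrDl ler_wpM2r// -subr_ge0.
    rewrite [leRHS](_ : _ = K^-1 * (K - 1) ^+ 2).
      by rewrite mulr_ge0 ?sqr_ge0// invr_ge0 ltW.
    by field; rewrite gt_eqF.
rewrite -B'E.
apply: (@lebesgue_rV_expanding _ _ K B' D (fun w => F (w *m invmx L))) => //.
- exact: ltW.
- apply: (@measurable_comp _ _ _ _ _ _ B
    (F : borel 'rV[R]_n -> borel 'rV[R]_n) B'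
    ((fun w => w *m invmx L) : borel 'rV[R]_n -> borel 'rV[R]_n)) => //.
  + by move=> _ [w Bw <-].
  + apply: (@measurable_funS _ _ _ _ (U : set (borel 'rV[R]_n))).
    * exact: open_measurable_borel.
    * by move=> x /Bz /rU.
    * apply: (@open_continuous_borel 'rV[R]_n 'rV[R]_n) => // x Ux.
      exact: Ck1_continuous CF Ux.
  + apply: (@measurable_funS _ _ _ _ setT) => //.
    apply: (@continuous_borel 'rV[R]_n 'rV[R]_n).
    exact: mulmxr_continuous.
- by move=> w /BD.
- move=> w w' Bw Bw'.
  have := Fd _ _ (Bz _ Bw') (Bz _ Bw); rewrite mulmxBl !mulmxKV//.
  set a := F _ - F _ => ab; rewrite mulrC -ler_pdivrMr//.
  have := ler_distD a (w - w') 0; rewrite !subr0 distrC => wa.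
  have := le_trans wa (lerD ab (lexx _)).
  by rewrite mulrBl mul1r [K^-1 * _]mulrC; lra.
Qed.

End C1_maps.

(** * Alternating forms of top degree *)

Section alternating_forms.
Variables (R : comNzRingType) (n : nat).

Definition multilinear (f : 'M[R]_n -> R) :=
  forall (V V1 V2 : 'M[R]_n) (i : 'I_n) (a b : R),
  row i V = a *: row i V1 + b *: row i V2 ->
  row' i V1 = row' i V -> row' i V2 = row' i V ->
  f V = a * f V1 + b * f V2.

Definition alternating (f : 'M[R]_n -> R) :=
  forall (V : 'M[R]_n) (i j : 'I_n), i != j -> row i V = row j V -> f V = 0.

Definition set_row (V : 'M[R]_n) (i : 'I_n) (r : 'rV[R]_n) : 'M[R]_n :=
  \matrix_k (if k == i then r else row k V).

Let row_set_row V i r : row i (set_row V i r) = r.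
Proof. by rewrite rowK eqxx. Qed.

Let row_set_row_neq V i k r : k != i -> row k (set_row V i r) = row k V.
Proof. by rewrite rowK => /negPf ->. Qed.

Let row'_set_row V i r : row' i (set_row V i r) = row' i V.
Proof.
apply/row_matrixP => k; rewrite !row_rowsub row_set_row_neq//.
by rewrite eq_sym neq_lift.
Qed.

Let set_row_id V i : set_row V i (row i V) = V.
Proof. by apply/row_matrixP => k; rewrite rowK; case: eqP => [->|]. Qed.

Lemma multilinear_set_row f V i a b r s : multilinear f ->
  f (set_row V i (a *: r + b *: s)) =
  a * f (set_row V i r) + b * f (set_row V i s).
Proof.
by move=> /(_ _ _ _ i); apply; rewrite ?row_set_row// !row'_set_row.
Qed.

(** Expand the form on the matrix whose rows [i] and [j] are both the sum of the
    rows [i] and [j] of [V]. *)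
Lemma alternating_xrow f V i j : multilinear f -> alternating f -> i != j ->
  f (xrow i j V) = - f V.
Proof.
move=> fl fa ij; have ji : j != i by rewrite eq_sym.
pose T x y := set_row (set_row V i x) j y.
have TD1 x y z : f (T (x + y) z) = f (T x z) + f (T y z).
  have set_rowC w : T w z = set_row (set_row V j z) i w.
    apply/row_matrixP => k; rewrite !rowK.
    by case: (eqVneq k i) => [->|//]; rewrite (negPf ij).
  rewrite !set_rowC -[x]scale1r -[y]scale1r multilinear_set_row// !mul1r.
  by rewrite !scale1r.
have TD2 x y z : f (T x (y + z)) = f (T x y) + f (T x z).
  rewrite /T -[y]scale1r -[z]scale1r multilinear_set_row// !mul1r.
  by rewrite !scale1r.
have T0 x : f (T x x) = 0.
  by apply: (fa _ i j) => //; rewrite row_set_row row_set_row_neq// row_set_row.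
have TV : T (row i V) (row j V) = V.
  rewrite /T -[in X in set_row _ _ X](row_set_row_neq V (row i V) ji).
  by rewrite !set_row_id.
have TX : T (row j V) (row i V) = xrow i j V.
  apply/row_matrixP => k; rewrite !rowK.
  case: (eqVneq k j) => [->|kj].
    by apply/rowP => l; rewrite !mxE perm.tpermR.
  case: (eqVneq k i) => [->|ki].
    by apply/rowP => l; rewrite !mxE perm.tpermL.
  by apply/rowP => l; rewrite !mxE perm.tpermD// eq_sym.
rewrite -TX -[in RHS]TV; apply/eqP; rewrite -addr_eq0.
have := T0 (row i V + row j V); rewrite TD1 !TD2 !T0 add0r addr0 addrC.
by move/eqP.
Qed.

(** By multilinearity it suffices to treat matrices whose rows are vectors of the
    standard basis. The form vanishes if two rows agree; otherwise the matrix is a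
    permutation matrix, and row exchanges lead back to the identity. *)
Lemma alternating_eq0 f : multilinear f -> alternating f -> f 1%:M = 0 ->
  forall V, f V = 0.
Proof.
move=> fl fa f1.
have fperm s : f (perm_mx s) = 0.
  have [ts -> _] := perm.prod_tpermP s.
  elim: ts => [|[i j] ts IH].
    by rewrite big_nil perm_mx1.
  rewrite big_cons perm_mxM -xrowE /=; have [->|ij] := eqVneq i j.
    by rewrite /xrow perm.tperm1 row_perm1.
  by rewrite alternating_xrow// IH oppr0.
(* At stage [k], only the first [k] rows may differ from basis vectors. *)
have basis k : forall V, (forall i : 'I_n, (k <= i)%N ->
    exists j, row i V = delta_mx 0 j) -> f V = 0.
  elim: k => [|k IH] V Vb.
    pose s i := sval (cid (Vb i (leq0n i))).
    have rowE i : row i V = delta_mx 0 (s i) by exact: svalP (cid (Vb i _)).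
    have [/injectiveP sI|/injectivePn[i [j ij sij]]] := boolP (injectiveb s).
      rewrite (_ : V = perm_mx (perm.perm sI)) ?fperm//.
      apply/row_matrixP => i; rewrite rowE; apply/rowP => j.
      by rewrite !mxE perm.permE eq_sym.
    by apply: (fa _ _ _ ij); rewrite !rowE sij.
  have [kn|nk] := ltnP k n; last first.
    by apply: IH => i; rewrite leqNgt (leq_trans (ltn_ord i)).
  pose i0 := Ordinal kn.
  rewrite -(set_row_id V i0) [row i0 V]row_sum_delta.
  elim/big_rec: _ => [|j x _ fx].
    have := multilinear_set_row V i0 0 0 0 0 fl.
    by rewrite !scale0r addr0 !mul0r addr0.
  rewrite -[x]scale1r multilinear_set_row// fx mulr0 addr0 IH ?mulr0// => i ki.
  have [->|ii0] := eqVneq i i0; first by exists j; rewrite row_set_row.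
  rewrite row_set_row_neq//; apply: Vb; rewrite ltn_neqAle ki andbT.
  by apply: contra ii0 => /eqP ki0; apply/eqP/val_inj.
by move=> V; apply: (basis n) => i; rewrite leqNgt ltn_ord.
Qed.

(** The difference of the two sides is an alternating form that vanishes at the
    identity. *)
Lemma alternating_det f V : multilinear f -> alternating f ->
  f V = \det V * f 1%:M.
Proof.
move=> fl fa; apply/eqP; rewrite -subr_eq0; apply/eqP.
apply: (@alternating_eq0 (fun W => f W - \det W * f 1%:M)); last first.
- by rewrite det1 mul1r subrr.
- move=> W i j ij Wij; rewrite (fa _ _ _ ij Wij) (determinant_alternate ij).
    by rewrite mul0r subr0.
  by move=> k; have := congr1 (fun r : 'rV_n => r 0 k) Wij; rewrite !mxE.
- move=> W V1 V2 i a b Wi V1i V2i; rewrite (fl _ _ _ _ _ _ Wi V1i V2i).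
  by rewrite (determinant_multilinear Wi V1i V2i); ring.
Qed.

End alternating_forms.

(** * Comparison of measures on small open sets *)

Section small_sets.
Local Open Scope ereal_scope.

(** Estimates that each lose a factor close to 1 are chained; this chooses that
    factor from the total loss [K] allowed. *)
Lemma root_gt1 (R : realType) (K : R) m : (1 < K)%R ->
  exists2 k : R, (1 < k)%R & (k ^+ m <= K)%R.
Proof.
move=> K1; have K0 : (0 < K)%R by apply: lt_trans K1.
set k := (K `^ m.+1%:R^-1)%R; have k0 : (0 <= k)%R by exact: powR_ge0.
have kK : (k ^+ m.+1)%R = K.
  by rewrite -powR_mulrn// -powRrM mulVf// powRr1// ltW.
have k1 : (1 < k)%R.
  rewrite ltNge; apply/negP => k1; move: K1; rewrite -kK ltNge => /negP; apply.
  by rewrite exprn_ile1.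
by exists k => //; rewrite -[leRHS]kK ler_eXn2l.
Qed.

Lemma lee_mulgt1 (R : realType) (a b : \bar R) : 0 <= b ->
  (forall K : R, (1 < K)%R -> a <= K%:E * b) -> a <= b.
Proof.
case: b => [b|_ _|//]; last by rewrite leey.
rewrite lee_fin => b0 ab.
apply/lee_addgt0Pr => e e0.
have b1 : (0 < b + 1)%R by rewrite ltr_wpDl.
apply: le_trans (ab (1 + e / (b + 1))%R _) _.
  by rewrite ltrDl divr_gt0.
rewrite -EFinM -EFinD lee_fin mulrDl mul1r lerD2l -mulrA ler_piMr ?ltW//.
by rewrite mulrC ltr_pdivrMr// mul1r ltrDl.
Qed.

(** Each point of [E] lies in a member of a countable base on which the inequality
    still holds; made disjoint, these members cut [E] into countably many
    pieces. *)
Lemma le_measure_local (R : realType) (T : ptopologicalType)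
    (mu nu : {measure set (borel T) -> \bar R}) (E : set (borel T)) :
  @second_countable T -> measurable E ->
  (forall x, E x -> exists W : set T, [/\ open W, W x &
    forall A : set (borel T), measurable A -> A `<=` W -> A `<=` E ->
      mu A <= nu A]) ->
  mu E <= nu E.
Proof.
move=> [B cB [oB Bbasis]] mE locE.
have /countable_injP[f fI] := cB.
pose good (b : set T) := B b /\ forall A : set (borel T), measurable A ->
  A `<=` b -> A `<=` E -> mu A <= nu A.
(* [f] is injective on the base [B], so [G] runs through its good members. *)
pose G i : set (borel T) := xget set0 [set b | good b /\ f b = i].
have Ggood i : G i = set0 \/ good (G i).
  rewrite /G; case: xgetP => [b _ [gb _]|_]; [by right|by left].
have mG i : measurable (G i).
  have [->//|[/oB oG _]] := Ggood i.
  exact: open_measurable_borel.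
have EG : E = \bigcup_i (E `&` seqDU G i).
  rewrite -setI_bigcupr -seqDU_bigcup_eq; apply/esym/setIidPl => x Ex.
  have [W [oW Wx WE]] := locE x Ex.
  have [b [Bb bx] bW] := Bbasis x _ (open_nbhs_nbhs (conj oW Wx)).
  have gb : good b by split=> // A mA Ab; apply: WE => //; exact: subset_trans bW.
  exists (f b) => //; rewrite /G; case: xgetP => [b' _ [[Bb' _] fb']|/(_ b)].
    by rewrite (fI b' b)// inE.
  by case.
have mEG i : measurable (E `&` seqDU G i).
  by apply: measurableI => //; exact: seqDU_measurable.
have tEG : trivIset setT (fun i => E `&` seqDU G i).
  by apply: trivIset_setIl; exact: trivIset_seqDU.
have mUEG : measurable (\bigcup_i (E `&` seqDU G i)) by exact: bigcupT_measurable.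
rewrite EG !measure_semi_bigcup//; apply: lee_nneseries => // i _.
have [G0|[_ gG]] := Ggood i.
  suff -> : E `&` seqDU G i = set0 by rewrite !measure0.
  by apply/seteqP; split=> // x [_ [+ _]]; rewrite G0.
by apply: gG => // x [] // _ [].
Qed.

Lemma near_ratio (R : realType) (T : topologicalType) (f : T -> R) (x : T) (K : R) :
  (1 < K)%R -> {for x, continuous f} -> f x != 0%R ->
  \forall y \near x, (`|f y| <= K * `|f x| /\ `|f x| <= K * `|f y|)%R.
Proof.
move=> K1 cf fx0; have K0 : (0 < K)%R by apply: lt_trans K1.
have f0 : (0 < `|f x|)%R by rewrite normr_gt0.
have cn : `|f y|%R @[y --> x] --> `|f x|%R by exact: cvg_norm.
near=> y; split; apply: ltW; near: y.
- by apply: (cvgr_lt _ cn); rewrite ltr_pMl.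
- near=> y; rewrite mulrC -ltr_pdivrMr//; near: y.
  by apply: (cvgr_gt _ cn); rewrite ltr_pdivrMr// ltr_pMr.
Unshelve. all: by end_near. Qed.

Lemma integral_norm_bounds (R : realType) (V : ptopologicalType)
    (mu : {measure set (borel V) -> \bar R}) (D : set (borel V)) (g : borel V -> R)
    (a b : R) : measurable D -> measurable_fun D g -> (0 <= a)%R ->
  (forall x, D x -> (a <= `|g x| <= b)%R) ->
  a%:E * mu D <= \int[mu]_(x in D) `|g x|%:E <= b%:E * mu D.
Proof.
move=> mD mg a0 gab; have mng : measurable_fun D (fun x => `|g x|%:E).
  apply/measurable_EFinP; exact: measurableT_comp mg.
rewrite -!integral_cst//; apply/andP; split; apply: ge0_le_integral => //.
- by move=> x /gab/andP[]; rewrite lee_fin.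
- by move=> x /gab/andP[]; rewrite lee_fin.
Qed.

Lemma open_preimage_on (S T : topologicalType) (D : set S) (f : S -> T)
    (U : set T) :
  open D -> (forall x, D x -> {for x, continuous f}) -> open U ->
  open [set x | D x /\ U (f x)].
Proof.
move=> oD cf oU; rewrite openE => x [Dx Ufx].
apply: (@filterI _ (nbhs x)); first exact: open_nbhs_nbhs.
by apply: (cf x Dx); exact: open_nbhs_nbhs.
Qed.

End small_sets.

(** * Local change of variables *)

Section chart_measurability.
Variables (R : realType) (n : nat) (T : ptopologicalType) (c : chart R n T).

Lemma chart_image (A : set T) : A `<=` chart_dom c ->
  c @` A = chart_img c `&` chart_inv c @^-1` A.
Proof.
move=> Ac; apply/seteqP; split=> [_ [x Ax <-]|y [yc Ay]].
  by split; [exact/chart_map_img/Ac|rewrite /= chart_mapK//; exact: Ac].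
by exists (chart_inv c y) => //; rewrite chart_invK.
Qed.

Lemma measurable_chart_image (A : set (borel T)) : measurable A ->
  A `<=` chart_dom c -> measurable (c @` A : set (borel 'rV[R]_n)).
Proof.
move=> mA Ac; rewrite chart_image//.
apply: (@open_continuous_borel 'rV[R]_n T (chart_img c) (chart_inv c)) => //.
- exact: chart_img_open.
- by move=> y; exact: chart_inv_continuous.
- apply: open_measurable_borel; exact: chart_img_open.
Qed.

End chart_measurability.

Section change_of_variables.
Variables (R : realType) (n : nat) (M N : manifold R n).
Variables (oM : orientation M) (oN : orientation N).
Variables (muM : nform M) (muN : nform N).
Hypotheses (hmuM : volume_form oM muM) (hmuN : volume_form oN muN).
Variables (phi : M -> N) (phiV : N -> M).
Hypotheses (hphi : diffeomorphism phi phiV).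
Hypotheses (hor : orientation_preserving oM oN phi).
Variables (J : M -> R) (hJ : jacobian_determinant muM muN phi J).
Variable volM : {measure set (borel M) -> \bar R}.
Hypothesis hvolM : volume_measure muM volM.
Variable volN : {measure set (borel N) -> \bar R}.
Hypothesis hvolN : volume_measure muN volN.
Notation lam := (lebesgue_rV R n).

Lemma form_val_det (P : manifold R n) (w : nform P) (c : chart R n P) x V :
  atlas P c -> chart_dom c x ->
  form_val w c x V = \det V * form_val w c x 1%:M.
Proof.
move=> Pc cx; apply: alternating_det.
- exact: form_multilinear.
- exact: form_alternating.
Qed.

Lemma volume_form_neq0 (P : manifold R n) (o : orientation P) (w : nform P)
    (c : chart R n P) x :
  volume_form o w -> atlas P c -> chart_dom c x -> form_val w c x 1%:M != 0.
Proof.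
move=> ow Pc cx; have := ow c x Pc cx 1%:M (unitmx1 _ _).
by apply: contraTneq => ->; rewrite mulr0 ltxx.
Qed.

Lemma volume_density_continuous (P : manifold R n) (w : nform P)
    (c : chart R n P) y : atlas P c -> chart_img c y ->
  {for y, continuous (fun z => form_val w c (chart_inv c z) 1%:M : R)}.
Proof. by move=> Pc cy; have := form_smooth w Pc 1%:M 0%N y cy. Qed.

Lemma volume_density_measurable (P : manifold R n) (w : nform P)
    (c : chart R n P) (A : set P) : atlas P c -> A `<=` chart_dom c ->
  measurable_fun (c @` A : set (borel 'rV[R]_n))
    ((fun z => form_val w c (chart_inv c z) 1%:M) : borel 'rV[R]_n -> R).
Proof.
move=> Pc Ac; apply: (@measurable_funS _ _ _ _ (chart_img c : set (borel _))).
- apply: open_measurable_borel; exact: chart_img_open.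
- by move=> _ [x /Ac cx <-]; exact: chart_map_img.
- apply: (@continuous_borel_real R 'rV[R]_n); first exact: chart_img_open.
  by move=> y; exact: volume_density_continuous.
Qed.

Lemma jacobian_unit c d x : atlas M c -> atlas N d -> chart_dom c x ->
  chart_dom d (phi x) -> 'J (local_expr phi c d) (c x) \in unitmx.
Proof.
move=> Mc Nd cx dx; rewrite unitmxE unitfE.
have := hor Mc Nd cx dx; apply: contraTneq => ->; by rewrite mulr0 ltxx.
Qed.

Lemma jacobian_density c d x : atlas M c -> atlas N d -> chart_dom c x ->
  chart_dom d (phi x) ->
  J x * form_val muM c x 1%:M =
  \det ('J (local_expr phi c d) (c x)) * form_val muN d (phi x) 1%:M.
Proof.
by move=> Mc Nd cx dx; rewrite -(hJ Mc Nd cx dx) mul1mx form_val_det.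
Qed.

(** The three orientation signs, of [M], of [N] and of the derivative, cancel. *)
Lemma jacobian_gt0 x : 0 < J x.
Proof.
have [c Mc cx] := atlas_cover x; have [d Nd dx] := atlas_cover (phi x).
have := jacobian_density Mc Nd cx dx.
have := hor Mc Nd cx dx.
have := hmuM Mc cx (unitmx1 R n); have := hmuN Nd dx (unitmx1 R n).
rewrite det1 !mulr1.
set a := form_val _ _ _ _; set b := form_val _ _ _ _; set D := \det _.
set s := _ ^+ _; set t := _ ^+ _ => sa tb tsD JE.
have s2 : s * s = 1 by rewrite -expr2 sqrr_sign.
have : 0 < (t * s * D) * (s * a).
  by rewrite mulr_gt0.
rewrite (_ : _ * _ * _ * _ = (s * s) * t * (D * a)); last by ring.
by rewrite s2 mul1r -JE mulrCA pmulr_lgt0.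
Qed.

(** In charts [c] at [x0] and [d] at [phi x0], the two volumes are integrals of
    [|gM|] over [B = c A] and of [|gN|] over [D = d (phi A)]. On a small
    neighbourhood these densities are constant up to a factor [k], the volumes of
    [B] and [D] have ratio [|det ('J F z0)|] up to [k ^ n], and
    [J x0 * |gM z0| = |det ('J F z0)| * |gN (F z0)|]. *)
Lemma volume_local (x0 : M) (K : R) : 1 < K ->
  exists W : set M, [/\ open W, W x0 &
    forall A : set (borel M), measurable A -> A `<=` W ->
      (volN (phiV @^-1` A) <= (K * J x0)%:E * volM A)%E /\
      ((J x0)%:E * volM A <= K%:E * volN (phiV @^-1` A))%E].
Proof.
move=> K1; have K0 : 0 < K by apply: lt_trans K1.
have [k k1 kK] := root_gt1 (n + 2) K1.
have k0 : 0 < k by apply: lt_trans k1.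
have [[cphi sphi] [cphiV sphiV] phiK phiVK] := hphi.
have [c Mc cx0] := atlas_cover x0; have [d Nd dx0] := atlas_cover (phi x0).
pose F := local_expr phi c d; pose G := local_expr phiV d c.
pose U := local_dom phi c d; set z0 := c x0.
have oU : open U.
  apply: open_preimage_on.
  - exact: chart_img_open.
  - move=> y cy; apply: (@continuous_comp _ _ _ (chart_inv c) phi).
      exact: chart_inv_continuous.
    exact: cphi.
  - exact: chart_dom_open.
have Uz0 : U z0.
  by split; [exact: chart_map_img|rewrite /z0 chart_mapK].
have CF : Ck_on 1 U F by exact: sphi.
have uJ : 'J F z0 \in unitmx by exact: jacobian_unit.
have [r r0 [rU BD]] := lebesgue_rV_near oU CF Uz0 uJ k1.
pose gM z := form_val muM c (chart_inv c z) 1%:M.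
pose gN y := form_val muN d (chart_inv d y) 1%:M.
have FE z : U z -> F z = d (phi (chart_inv c z)) by [].
have JE z : U z -> J (chart_inv c z) * gM z = \det ('J F z) * gN (F z).
  move=> [cz dz]; have := jacobian_density Mc Nd (chart_inv_dom cz) dz.
  by rewrite chart_invK// /gN /F /local_expr/= chart_mapK.
have gM0 z : chart_img c z -> gM z != 0.
  by move=> cz; apply: volume_form_neq0 hmuM Mc _; exact: chart_inv_dom.
have gN0 y : chart_img d y -> gN y != 0.
  by move=> dy; apply: volume_form_neq0 hmuN Nd _; exact: chart_inv_dom.
have dF z : U z -> chart_img d (F z) by move=> [_ dz]; exact: chart_map_img.
pose V := [set z | ball z0 r z /\
  (`|gM z| <= k * `|gM z0| /\ `|gM z0| <= k * `|gM z|) /\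
  (`|gN (F z)| <= k * `|gN (F z0)| /\ `|gN (F z0)| <= k * `|gN (F z)|)].
have nV : nbhs z0 V.
  apply: filterI; first exact: nbhsx_ballx.
  have n1 := near_ratio k1 (@volume_density_continuous M muM c z0 Mc Uz0.1)
    (gM0 _ Uz0.1).
  have n2 : \forall z \near z0, `|gN (F z)| <= k * `|gN (F z0)| /\
      `|gN (F z0)| <= k * `|gN (F z)|.
    apply: (@near_ratio _ _ (gN \o F)) => //; last by apply: gN0; exact: dF.
    apply: continuous_comp; first exact: Ck1_continuous CF Uz0.
    by apply: volume_density_continuous => //; exact: dF.
  by near=> z; split; near: z.
have [V' [oV' V'z0] V'V] : exists2 V', open_nbhs z0 V' & V' `<=` V.
  by move: nV; rewrite nbhsE => -[V' ? ?]; exists V'.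
exists [set x | chart_dom c x /\ V' (c x)]; split.
- apply: open_preimage_on => //; first exact: chart_dom_open.
  by move=> x; exact: chart_map_continuous.
- by split.
move=> A mA AW.
pose A' := phiV @^-1` A.
pose B : set (borel 'rV[R]_n) := c @` A.
pose D : set (borel 'rV[R]_n) := d @` A'.
have Ac : A `<=` chart_dom c by move=> x /AW[].
have AV x : A x -> V (c x) by move=> /AW[_ /V'V].
have AU x : A x -> U (c x) by move=> /AV[/rU].
have A'd : A' `<=` chart_dom d.
  by move=> y A'y; have [_] := AU _ A'y; rewrite chart_mapK ?phiVK//; exact: Ac.
have mA' : measurable (A' : set (borel N)).
  rewrite -[X in measurable X]setTI.
  exact: (@continuous_borel N M phiV cphiV).
have mB : measurable B by exact: measurable_chart_image.
have mD : measurable D by exact: measurable_chart_image.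
have BF z : B z -> D (F z).
  move=> [x Ax <-]; exists (phi x); first by rewrite /A'/= phiK.
  by rewrite /F /local_expr/= chart_mapK//; exact: Ac.
have DG y : D y -> B (G y) /\ F (G y) = y.
  move=> [x A'x <-]; rewrite /F /G /local_expr/= (chart_mapK (A'd _ A'x)).
  split; first by exists (phiV x).
  by rewrite chart_mapK ?phiVK//; exact: Ac.
have mG : measurable_fun D (G : borel 'rV[R]_n -> borel 'rV[R]_n).
  have oU' : open (local_dom phiV d c).
    apply: open_preimage_on.
    - exact: chart_img_open.
    - move=> y dy; apply: (@continuous_comp _ _ _ (chart_inv d) phiV).
        exact: chart_inv_continuous.
      exact: cphiV.
    - exact: chart_dom_open.
  apply: (@measurable_funS _ _ _ _ (local_dom phiV d c : set (borel _))).
  - exact: open_measurable_borel.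
  - move=> _ [x A'x <-]; split; first exact/chart_map_img/A'd.
    by rewrite chart_mapK; [exact: Ac|exact: A'd].
  - apply: (@open_continuous_borel 'rV[R]_n 'rV[R]_n) => // y.
    exact: (sphiV d c Nd Mc 0%N y).
have [DB1 DB2] : (lam D <= (k ^+ n * `|\det ('J F z0)|)%:E * lam B)%E /\
    ((`|\det ('J F z0)|)%:E * lam B <= (k ^+ n)%:E * lam D)%E.
  by apply: (BD B D G) => // _ [x Ax <-]; have [] := AV x Ax.
have gMbound : ((`|gM z0| / k)%:E * lam B <= volM A <= (k * `|gM z0|)%:E * lam B)%E.
  rewrite (hvolM Mc mA Ac); apply: integral_norm_bounds => //.
  - exact: volume_density_measurable.
  - by rewrite divr_ge0// ltW.
  - move=> _ [x Ax <-]; have [_ [[gM1 gM2] _]] := AV x Ax.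
    by rewrite gM1 ler_pdivrMr// mulrC gM2.
have gNbound : ((`|gN (F z0)| / k)%:E * lam D <= volN A' <=
    (k * `|gN (F z0)|)%:E * lam D)%E.
  rewrite (hvolN Nd mA' A'd); apply: integral_norm_bounds => //.
  - exact: volume_density_measurable.
  - by rewrite divr_ge0// ltW.
  - move=> y /DG[[x Ax xG] <-]; rewrite -xG.
    have [_ [_ [gN1 gN2]]] := AV x Ax.
    by rewrite gN1 ler_pdivrMr// mulrC gN2.
have Jx0 := jacobian_gt0 x0.
have gMx0 : 0 < `|gM z0| by rewrite normr_gt0 gM0//; exact: Uz0.1.
have J0E : J x0 * `|gM z0| = `|\det ('J F z0)| * `|gN (F z0)|.
  by rewrite -normrM -JE// normrM /z0 chart_mapK// gtr0_norm.
have {}kK : k ^+ n * (k * k) <= K.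
  apply: le_trans kK; rewrite -expr2 -exprD; apply: ler_weXn2l; first exact: ltW.
  by rewrite leq_add2l.
have lB0 : (0 <= lam B)%E by exact: measure_ge0.
have lD0 : (0 <= lam D)%E by exact: measure_ge0.
move: lB0 lD0 gMbound gNbound DB1 DB2 J0E gMx0; move: (lam B) (lam D) => b e.
set m := `|gM z0|; set p := `|gN (F z0)|; set D0 := `|\det _|.
have p0 : 0 <= p by exact: normr_ge0.
have D00 : 0 <= D0 by exact: normr_ge0.
have kp0 : (0 <= (k * p)%:E)%E by rewrite lee_fin mulr_ge0// ltW.
have Jx0' : (0 <= (J x0)%:E)%E by rewrite lee_fin ltW.
move=> b0 e0 /andP[vM1 vM2] /andP[vN1 vN2] eb be Jm m0; split.
  apply: (@le_trans _ _ ((K * J x0)%:E * ((m / k)%:E * b))%E); last first.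
    by apply: lee_wpmul2l vM1; rewrite lee_fin mulr_ge0// ltW.
  apply: le_trans vN2 _; apply: le_trans (lee_wpmul2l kp0 eb) _.
  rewrite !muleA -!EFinM; apply: lee_wpmul2r; first exact: b0.
  rewrite lee_fin.
  rewrite (_ : K * J x0 * (m / k) = K / k * (J x0 * m)); last by ring.
  rewrite Jm (_ : k * p * _ = k ^+ n * k * (D0 * p)); last by ring.
  by rewrite ler_wpM2r ?mulr_ge0// ler_pdivlMr// -mulrA.
apply: le_trans (lee_wpmul2l Jx0' vM2) _.
apply: (@le_trans _ _ (K%:E * ((p / k)%:E * e))%E); last first.
  by apply: lee_wpmul2l vN1; rewrite lee_fin ltW.
rewrite muleA -EFinM (_ : J x0 * _ = k * p * D0); last first.
  by rewrite mulrCA Jm; ring.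
rewrite EFinM -muleA; apply: le_trans (lee_wpmul2l kp0 be) _.
rewrite !muleA -!EFinM; apply: lee_wpmul2r; first exact: e0.
rewrite lee_fin mulrA ler_pdivlMr//.
rewrite (_ : k * p * k ^+ n * k = k ^+ n * (k * k) * p); last by ring.
by rewrite ler_wpM2r.
Unshelve. all: by end_near. Qed.

End change_of_variables.

(** * Norms under comparison of measures *)

Section Lnorm_comparison.
Local Open Scope ereal_scope.
Context d (T : measurableType d) (R : realType).
Variables (m1 m2 : {measure set T -> \bar R}) (f : T -> R).

Lemma Lnorm_le_measure (c r : R) :
  (0 <= c)%R -> (0 < r)%R -> measurable_fun setT f ->
  (forall A, measurable A -> m1 A <= c%:E * m2 A) ->
  'N[m1]_r%:E [EFin \o f] <= (c `^ r^-1)%:E * 'N[m2]_r%:E [EFin \o f].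
Proof.
move=> c0 r0 mf m12; rewrite unlock.
pose m2' := mscale (NngNum c0) m2.
have mg : measurable_fun setT (fun x => `|(EFin \o f) x| `^ r).
  rewrite [X in measurable_fun _ X](_ : _ = EFin \o (fun x => `|f x| `^ r)%R)//.
  apply/measurable_EFinP; apply: (measurableT_comp (measurable_powR r)).
  exact: measurableT_comp mf.
have int12 : \int[m1]_x `|(EFin \o f) x| `^ r <=
    c%:E * \int[m2]_x `|(EFin \o f) x| `^ r.
  rewrite -(ge0_integral_mscale m2 measurableT (NngNum c0))//; last first.
    by move=> x _; exact: poweR_ge0.
  apply: ge0_le_measure_integral => // x; exact: poweR_ge0.
have i0 (m : {measure set T -> \bar R}) : 0 <= \int[m]_x `|(EFin \o f) x| `^ r.
  by apply: integral_ge0 => x _; exact: poweR_ge0.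
rewrite -poweR_EFin -poweRM//.
apply: gt0_ler_poweR => //; first by rewrite invr_ge0 ltW.
- by rewrite in_itv/= leey i0.
- by rewrite in_itv/= leey mule_ge0.
Qed.

(** An essential bound depends on the measure only through its null sets. *)
Lemma Lnorm_le_dominated :
  (forall A, measurable A -> m2 A = 0 -> m1 A = 0) ->
  'N[m1]_+oo [EFin \o f] <= 'N[m2]_+oo [EFin \o f].
Proof.
move=> m12; rewrite unlock.
case: ifPn => [m1T|_]; last first.
  by case: ifPn => // m2T; apply: ess_sup_gee => //;
    apply: nearW => x; exact: abse_ge0.
have m2T : 0 < m2 setT.
  rewrite lt_neqAle measure_ge0 andbT; apply: contraTneq m1T => /esym/m12 ->//.
  by rewrite ltxx.
rewrite m2T; apply/ess_supP.
have [N [mN m2N sN]] := ess_sup_ge m2 (abse \o (EFin \o f)).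
by exists N; split=> //; exact: m12.
Qed.

End Lnorm_comparison.

(** * Measures with a continuous density *)

Section local_density.
Local Open Scope ereal_scope.
Variables (R : realType) (T : ptopologicalType).
Variables (mu nu : {measure set (borel T) -> \bar R}) (J : T -> R).

(** For continuous [J], this says that [nu] has density [J] with respect to [mu],
    in terms of the measures of small sets only. *)
Definition locally_density := forall (x0 : T) (K : R), (1 < K)%R ->
  exists W : set T, [/\ open W, W x0 &
    forall A : set (borel T), measurable A -> A `<=` W ->
      nu A <= (K * J x0)%:E * mu A /\ (J x0)%:E * mu A <= K%:E * nu A].

Hypotheses (sc : @second_countable T) (J0 : forall x, (0 < J x)%R).
Hypothesis density : locally_density.

Lemma density_null (E : set (borel T)) : measurable E -> mu E = 0 -> nu E = 0.
Proof.
move=> mE E0; apply/le_anti; rewrite measure_ge0 andbT -E0.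
apply: le_measure_local => // x _.
have [W [oW Wx WA]] := density x (ltr1n R 2).
exists W; split=> // A mA AW AE; have [nuA _] := WA A mA AW.
rewrite (subset_measure0 mA mE AE E0) in nuA *.
by apply: le_trans nuA _; rewrite mule0.
Qed.

Lemma null_density (E : set (borel T)) : measurable E -> nu E = 0 -> mu E = 0.
Proof.
move=> mE E0; apply/le_anti; rewrite measure_ge0 andbT -E0.
apply: le_measure_local => // x _.
have [W [oW Wx WA]] := density x (ltr1n R 2).
exists W; split=> // A mA AW AE; have [_] := WA A mA AW.
rewrite (subset_measure0 mA mE AE E0) mule0 => JA.
have Jx : 0 < (J x)%:E by rewrite lte_fin.
by move: JA; rewrite pmule_rle0.
Qed.

(** Around a point [x] of [E], [nu] is at most [K * J x * mu], hence at most
    [K * C * mu]; then [K] tends to 1. *)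
Lemma density_le (C : R) (E : set (borel T)) : measurable E -> (0 <= C)%R ->
  (forall x, E x -> (J x <= C)%R) -> nu E <= C%:E * mu E.
Proof.
move=> mE C0 EC; apply: lee_mulgt1 => [|K K1].
  by rewrite mule_ge0.
have K0 : (0 < K)%R by apply: lt_trans K1.
have KC0 : (0 <= K * C)%R by rewrite mulr_ge0// ltW.
rewrite muleA -EFinM.
apply: (@le_measure_local _ _ nu (mscale (NngNum KC0) mu)) => // x Ex.
have [W [oW Wx WA]] := density x K1.
exists W; split=> // A mA AW AE.
rewrite [leRHS](_ : _ = (K * C)%:E * mu A)//.
apply: le_trans (WA A mA AW).1 _; rewrite lee_wpmul2r// lee_fin ler_pM2l//.
exact: EC.
Qed.

Lemma density_ge (C : R) (E : set (borel T)) : measurable E -> (0 <= C)%R ->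
  (forall x, E x -> (C <= J x)%R) -> C%:E * mu E <= nu E.
Proof.
move=> mE C0 EC; apply: lee_mulgt1 => [|K K1].
  exact: measure_ge0.
have K0 : (0 <= K)%R by apply: le_trans (ltW K1).
apply: (@le_measure_local _ _ (mscale (NngNum C0) mu) (mscale (NngNum K0) nu))
  => // x Ex.
have [W [oW Wx WA]] := density x K1.
exists W; split=> // A mA AW AE.
apply: le_trans (WA A mA AW).2.
rewrite [leLHS](_ : _ = C%:E * mu A)// lee_wpmul2r// lee_fin.
exact: EC.
Qed.

Lemma density_ae_le (C : R) (A : set (borel T)) : measurable A -> (0 <= C)%R ->
  {ae mu, forall x, (J x <= C)%R} -> nu A <= C%:E * mu A.
Proof.
move=> mA C0 [Z [mZ Z0 JZ]].
apply: (@le_trans _ _ (nu (A `\` Z) + nu (A `&` Z))).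
  by rewrite -measureDI.
rewrite (@density_null (A `&` Z)) ?adde0; last 2 first.
- exact: measurableI.
- exact: (subset_measure0 (measurableI A Z mA mZ) mZ (@subIsetr _ A Z) Z0).
apply: (@le_trans _ _ (C%:E * mu (A `\` Z))).
  apply: density_le => //; first exact: measurableD.
  by move=> x [Ax nZx]; apply: contrapT => nJ; apply: nZx; apply: JZ.
by rewrite lee_wpmul2l// le_measure// inE//; exact: measurableD.
Qed.

Lemma density_ae_ge (C : R) (A : set (borel T)) : measurable A -> (0 <= C)%R ->
  {ae mu, forall x, (C <= J x)%R} -> C%:E * mu A <= nu A.
Proof.
move=> mA C0 [Z [mZ Z0 JZ]].
rewrite (measureDI _ mA mZ) [X in _ + X](_ : _ = 0); last first.
  exact: (subset_measure0 (measurableI A Z mA mZ) mZ (@subIsetr _ A Z) Z0).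
rewrite adde0; apply: (@le_trans _ _ (nu (A `\` Z))); last first.
  by rewrite le_measure// inE//; exact: measurableD.
apply: density_ge => //; first exact: measurableD.
by move=> x [Ax nZx]; apply: contrapT => nJ; apply: nZx; apply: JZ.
Qed.

Variable u : borel T -> R.
Hypothesis mfu : measurable_fun setT u.

(** For finite [p], the essential bound [k] of [J ^ (1/p)] gives [J <= k ^ p] almost
    everywhere, so [nu <= k ^ p * mu], and [k ^ p] has [p]-th root [k]. If [mu] is
    zero then so are [nu] and both norms. For infinite [p], [1/p] is 0 and the
    first factor on the right is the norm of the constant 1. *)
Lemma Lnorm_density_le (p : \bar R) : 1 <= p ->
  (exists C : R, forall x, (`|J x| <= C)%R) ->
  'N[nu]_p [EFin \o u] <=
  'N[mu]_+oo [EFin \o (fun x => J x `^ fine p^-1)%R] * 'N[mu]_p [EFin \o u].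
Proof.
case: p => [r|_ _|//]; last first.
  rewrite invey/=; under eq_fun do rewrite powRr0.
  have dom := Lnorm_le_dominated u density_null.
  have [muT|muT0] := ltP 0 (mu setT).
    suff -> : 'N[mu]_+oo [EFin \o (fun=> 1%R)] = 1 by rewrite mul1e.
    rewrite unlock muT; apply: ess_sup_ae_cst => //.
    by apply: nearW => x; rewrite /= normr1.
  apply: le_trans dom _; suff -> : 'N[mu]_+oo [EFin \o u] = 0 by rewrite mule0.
  by rewrite unlock ltNge muT0.
rewrite lee_fin => r1 [C JC]; have r0 : (0 < r)%R by apply: lt_le_trans r1.
rewrite inver gt_eqF//=.
set k := (X in _ <= X * _).
have k_ge0 : 0 <= k by exact: Lnorm_ge0.
have [muT|muT0] := ltP 0 (mu setT); last first.
  have nu0 A : measurable A -> nu A <= 0%:E * mu A.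
    move=> mA; rewrite mul0e (density_null mA)//.
    have muT : mu setT = 0 by apply/eqP; rewrite -measure_le0.
    exact: (subset_measure0 mA measurableT (@subsetT _ A) muT).
  apply: le_trans (Lnorm_le_measure (lexx _) r0 mfu nu0) _.
  by rewrite powR0 ?mul0e ?mule_ge0 ?Lnorm_ge0// gt_eqF ?invr_gt0.
have kE : k = ess_sup mu (abse \o (EFin \o (fun x => J x `^ r^-1)%R)).
  by rewrite /k unlock muT.
have kfin : k \is a fin_num.
  rewrite ge0_fin_numE// kE.
  apply: (@le_lt_trans _ _ (C `^ r^-1)%:E); last exact: ltry.
  apply/ess_supP; apply: nearW => x; rewrite /= lee_fin ger0_norm ?powR_ge0//.
  have r1_ge0 : (0 <= r^-1)%R by rewrite invr_ge0 ltW.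
  have Jx0 := ltW (J0 x); have JxC : (J x <= C)%R.
    by apply: le_trans (JC x); exact: ler_norm.
  by apply: ge0_ler_powR; rewrite ?nnegrE// (le_trans Jx0).
have Jk : {ae mu, forall x, (J x <= fine k `^ r)%R}.
  have := ess_sup_ge mu (abse \o (EFin \o (fun x => J x `^ r^-1)%R)).
  rewrite -kE; apply: filterS => x /=.
  rewrite -[in X in X -> _](fineK kfin) lee_fin ger0_norm ?powR_ge0// => Jxk.
  rewrite -[leLHS]powRr1; last exact: ltW.
  rewrite -(@mulVf _ r) ?gt_eqF// powRrM.
  by apply: ge0_ler_powR; rewrite ?nnegrE ?powR_ge0 ?fine_ge0//; exact: ltW.
have numu A : measurable A -> nu A <= (fine k `^ r)%:E * mu A.
  by move=> mA; apply: density_ae_le => //; exact: powR_ge0.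
apply: le_trans (Lnorm_le_measure (powR_ge0 _ _) r0 mfu numu) _.
by rewrite -powRrM divff ?gt_eqF// powRr1 ?fine_ge0// fineK.
Qed.

(** Dually, if [k] is a finite essential bound of [J ^ (-1/p)] then
    [k ^ (- p) <= J] almost everywhere, so [mu <= k ^ p * nu]. If [k] is infinite
    then its inverse is 0; if [mu] is zero then [k] is 0, with infinite inverse,
    but the norm that it multiplies is 0. *)
Lemma Lnorm_density_ge (p : \bar R) : 1 <= p ->
  ('N[mu]_+oo [EFin \o (fun x => J x `^ (- fine p^-1))%R])^-1 *
    'N[mu]_p [EFin \o u] <= 'N[nu]_p [EFin \o u].
Proof.
have [muT0|muT] := leP (mu setT) 0 => p1.
  suff -> : 'N[mu]_p [EFin \o u] = 0 by rewrite mule0 Lnorm_ge0.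
  apply/le_anti; rewrite Lnorm_ge0 andbT.
  case: p p1 => [r|_|//]; last by rewrite unlock ltNge muT0.
  rewrite lee_fin => r1; have r0 : (0 < r)%R by apply: lt_le_trans r1.
  have mu0 A : measurable A -> mu A <= 0%:E * mu A.
    move=> mA; rewrite mul0e; apply: le_trans muT0.
    by apply: le_measure; rewrite ?inE.
  apply: le_trans (Lnorm_le_measure (lexx _) r0 mfu mu0) _.
  by rewrite powR0 ?mul0e// gt_eqF ?invr_gt0.
case: p p1 => [r|_|//]; last first.
  rewrite invey/=; under eq_fun do rewrite oppr0 powRr0.
  suff -> : 'N[mu]_+oo [EFin \o (fun=> 1%R)] = 1.
    by rewrite inve1 mul1e; apply: Lnorm_le_dominated; exact: null_density.
  rewrite unlock muT; apply: ess_sup_ae_cst => //.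
  by apply: nearW => x; rewrite /= normr1.
rewrite lee_fin => r1; have r0 : (0 < r)%R by apply: lt_le_trans r1.
rewrite inver gt_eqF//=; set k := (X in X^-1 * _).
have k_ge0 : 0 <= k by exact: Lnorm_ge0.
have kE : k = ess_sup mu (abse \o (EFin \o (fun x => J x `^ (- r^-1))%R)).
  by rewrite /k unlock muT.
have [->|kNy] := eqVneq k +oo; first by rewrite invey mul0e Lnorm_ge0.
have kfin : k \is a fin_num by rewrite ge0_fin_numE// ltey.
have Jk : {ae mu, forall x, (J x `^ (- r^-1) <= fine k)%R}.
  have := ess_sup_ge mu (abse \o (EFin \o (fun x => J x `^ (- r^-1))%R)).
  rewrite -kE; apply: filterS => x /=.
  by rewrite -[in X in X -> _](fineK kfin) lee_fin ger0_norm ?powR_ge0.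
have k0 : (0 < fine k)%R.
  rewrite lt_neqAle fine_ge0// andbT; apply/negP => /eqP k0.
  have [Z [mZ Z0 JZ]] := Jk.
  suff : mu setT = 0 by move=> muT0; rewrite muT0 ltxx in muT.
  apply: (subset_measure0 measurableT mZ _ Z0) => x _; apply: JZ => /=.
  by rewrite -k0; apply/negP; rewrite -ltNge powR_gt0.
have {}Jk : {ae mu, forall x, (fine k `^ (- r) <= J x)%R}.
  have aeF := ae_filter_ringOfSetsType mu.
  move: Jk; apply: (@filterS _ _ aeF) => x Jxk.
  rewrite -[leRHS]powRr1; last exact: ltW.
  rewrite -(@mulVf _ r) ?gt_eqF// -mulrNN powRrM.
  rewrite !(powRN _ r) lef_pV2 ?posrE ?powR_gt0//.
  by apply: ge0_ler_powR; rewrite ?nnegrE ?powR_ge0 ?fine_ge0//; exact: ltW.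
have munu A : measurable A -> mu A <= (fine k `^ r)%:E * nu A.
  move=> mA; have := density_ae_ge mA (powR_ge0 _ _) Jk.
  by rewrite powRN -lee_pdivrMl ?powR_gt0.
have := Lnorm_le_measure (powR_ge0 _ _) r0 mfu munu.
rewrite -powRrM divff ?gt_eqF// powRr1 ?fine_ge0// => muk.
by rewrite -(fineK kfin) inver gt_eqF// lee_pdivrMl.
Qed.

End local_density.

(** * Norms under image measures *)

Section Lnorm_image.
Local Open Scope ereal_scope.
Context d1 d2 (T1 : measurableType d1) (T2 : measurableType d2) (R : realType).
Variables (mu : {measure set T1 -> \bar R}) (f : T1 -> T2).
Hypothesis mf : measurable_fun setT f.

(** For finite [p] this is the change of variables for integrals of image measures;
    for infinite [p], preimages of null sets are null and conversely. *)
Lemma Lnorm_image (p : \bar R) (u : T2 -> R) : 1 <= p ->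
  measurable_fun setT u ->
  'N[image_measure mu mf]_p [EFin \o u] = 'N[mu]_p [EFin \o (u \o f)].
Proof.
case: p => [r p1 mfu|p1 mfu|//].
  rewrite unlock; congr (_ `^ _).
  rewrite (ge0_integral_pushforward mf mu (D := setT))//; last first.
    by move=> x _; exact: poweR_ge0.
  rewrite [X in measurable_fun _ X](_ : _ = EFin \o (fun x => `|u x| `^ r)%R)//.
  apply/measurable_EFinP; apply: (measurableT_comp (measurable_powR r)).
  exact: measurableT_comp mfu.
rewrite unlock.
rewrite [X in if X then _ else _](_ : _ = (0 < mu setT))//.
have mnu : measurable_fun setT (abse \o (EFin \o u)).
  by apply: measurableT_comp => //; exact/measurable_EFinP.
case: ifP => // _; rewrite !ess_supEmu0//.
exact: measurableT_comp mnu mf.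
Qed.

End Lnorm_image.

(** * The norm estimate *)

Local Open Scope ereal_scope.

Theorem corollary2 (R : realType) (n : nat) (M N : manifold R n)
    (oM : orientation M) (oN : orientation N)
    (muM : nform M) (hmuM : volume_form oM muM)
    (muN : nform N) (hmuN : volume_form oN muN)
    (phi : M -> N) (phiV : N -> M) (hphi : diffeomorphism phi phiV)
    (hor : orientation_preserving oM oN phi)
    (J : M -> R) (hJ : jacobian_determinant muM muN phi J)
    (hbd : exists C : R, forall x : M, (`|J x| <= C)%R)
    (volM : {measure set (borel M) -> \bar R}) (hvolM : volume_measure muM volM)
    (volN : {measure set (borel N) -> \bar R}) (hvolN : volume_measure muN volN)
    (p : \bar R) (hp : 1 <= p)
    (u : borel M -> R) (hu : u \in Lfun volM p) :
  ('N[volM]_+oo [EFin \o (fun x => J x `^ (- fine p^-1))%R])^-1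
      * 'N[volM]_p [EFin \o u]
    <= 'N[volN]_p [EFin \o (u \o phiV)]
  /\
  'N[volN]_p [EFin \o (u \o phiV)]
    <= 'N[volM]_+oo [EFin \o (fun x => J x `^ fine p^-1)%R]
      * 'N[volM]_p [EFin \o u].
Proof.
have [_ [cphiV _] _ _] := hphi.
have mphiV : measurable_fun setT (phiV : borel N -> borel M).
  exact: continuous_borel.
have dens : locally_density volM (image_measure volN mphiV) J.
  move=> x0 K K1.
  exact: (volume_local hmuM hmuN hphi hor hJ hvolM hvolN x0 K1).
have J0 := jacobian_gt0 hmuM hmuN hor hJ.
have sc := @manifold_second_countable _ _ M.
have mfu : measurable_fun setT u by have := sub_Lfun_mfun hu; rewrite inE.
rewrite -(Lnorm_image volN mphiV hp mfu); split.
- exact: Lnorm_density_ge.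
- exact: Lnorm_density_le.
Qed.
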